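(* Let $d\ge 0$ be an integer, let $X$ be a locally coherent and locally $d$-perfect scheme with structure sheaf $\mathcal{O}_X$, and let $\mathscr{P}_\bullet$ be a complex of vector bundles (not necessarily finite dimensional) on $X$. If there exists an open affine covering $\mathcal{U}$ of $X$ such that $\mathscr{P}_\bullet(U)$ is a totally acyclic complex of projective $\mathcal{O}_X(U)$-modules for every $U\in\mathcal{U}$, then $\mathscr{P}_\bullet$ is $\mathbf{F}$-totally acyclic.
   Context: A commutative ring $R$ is $d$-perfect if every flat $R$-module has projective dimension at most $d$. A scheme $X$ is locally coherent (resp. locally $d$-perfect) if for every open affine subset $U\subseteq X$ the ring $\mathcal{O}_X(U)$ is coherent (resp. $d$-perfect). A (not necessarily finite dimensional) vector bundle on $X$ is a quasi-coherent sheaf $\mathscr{P}$ such that the $\mathcal{O}_X(U)$-module $\mathscr{P}(U)$ is projective for every open affine subset $U\subseteq X$. A ($\mathbb{Z}$-indexed) complex $P_\bullet$ of projective $R$-modules is called totally acyclic if it is acyclic and $\operatorname{Hom}_R(P_\bullet,Q)$ is acyclic for every projective $R$-module $Q$. A complex $F_\bullet$ of flat $R$-modules is called $\mathbf{F}$-totally acyclic if it is acyclic and $I\otimes_R F_\bullet$ is acyclic for every injective $R$-module $I$. A complex $\mathscr{F}_\bullet$ of flat quasi-coherent sheaves on $X$ is called $\mathbf{F}$-totally acyclic if for every open affine subset $U\subseteq X$ the complex $\mathscr{F}_\bullet(U)$ of flat $\mathcal{O}_X(U)$-modules is $\mathbf{F}$-totally acyclic. *)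

(* Defs.v *)
From HB Require Import structures.
From mathcomp Require Import all_boot all_order all_algebra.
From mathcomp Require Import boolp classical_sets topology.

Set Implicit Arguments.
Unset Strict Implicit.
Unset Printing Implicit Defensive.

Import GRing.Theory.

Local Open Scope classical_set_scope.
Local Open Scope ring_scope.
Local Open Scope quotient_scope.

(* Rings are [comPzRingType]s, so that the zero ring is allowed: it is the    *)
(* ring of sections over the empty set.                                       *)

(** * Tensor products *)

(* Two formal sums of pairs [(m, n)] represent the same element of the tensor *)
(* product when no R-bilinear map separates them. This is the congruence      *)
(* generated by the bilinearity relations. Formal sums need no coefficients,  *)
(* because [a (m, n) = (a m, n)].                                             *)
Section Tensor.
Context (R : comPzRingType) (M N : lmodType R).

Definition is_bilinear (P : lmodType R) (b : M -> N -> P) : Prop :=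
  (forall n, linear (b ^~ n)) /\ (forall m, linear (b m)).

Definition bilinear_sum (P : lmodType R) (b : M -> N -> P)
  (s : seq (M * N)) : P := \sum_(x <- s) b x.1 x.2.

Definition tensor_rel (s t : seq (M * N)) : bool :=
  `[< forall (P : lmodType R) (b : M -> N -> P),
        is_bilinear b -> bilinear_sum b s = bilinear_sum b t >].

Lemma tensor_rel_refl : reflexive tensor_rel.
Proof. by move=> s; apply/asboolP. Qed.

Lemma tensor_rel_sym : symmetric tensor_rel.
Proof.
by move=> s t; apply/asboolP/asboolP => h P b hb; rewrite h.
Qed.

Lemma tensor_rel_trans : transitive tensor_rel.
Proof.
by move=> t s u /asboolP h1 /asboolP h2; apply/asboolP => P b hb;
  rewrite h1 // h2.
Qed.

Canonical tensor_equiv :=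
  EquivRel tensor_rel tensor_rel_refl tensor_rel_sym tensor_rel_trans.

Definition tensor : Type := {eq_quot tensor_equiv}.
HB.instance Definition _ := Choice.on tensor.

Definition tensor_class (s : seq (M * N)) : tensor :=
  \pi_({eq_quot tensor_equiv}) s.

Definition tensor_repr (x : tensor) : seq (M * N) :=
  repr (x : {eq_quot tensor_equiv}).

Definition pure_tensor (m : M) (n : N) : tensor := tensor_class [:: (m, n)].

Definition tensor_eval (P : lmodType R) (b : M -> N -> P) (x : tensor) : P :=
  bilinear_sum b (tensor_repr x).

Definition tensor_add (x y : tensor) : tensor :=
  tensor_class (tensor_repr x ++ tensor_repr y).

Definition tensor_scale (a : R) (x : tensor) : tensor :=
  tensor_class [seq (a *: p.1, p.2) | p <- tensor_repr x].

Lemma tensor_reprK x : tensor_class (tensor_repr x) = x.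
Proof. exact: reprK. Qed.

Lemma tensor_eval_class (P : lmodType R) (b : M -> N -> P) s :
  is_bilinear b -> tensor_eval b (tensor_class s) = bilinear_sum b s.
Proof.
move=> hb; rewrite /tensor_eval.
have /eqmodP/asboolP : tensor_class (tensor_repr (tensor_class s))
  = tensor_class s by exact: tensor_reprK.
exact.
Qed.

Lemma tensor_ext x y :
  (forall (P : lmodType R) (b : M -> N -> P),
     is_bilinear b -> tensor_eval b x = tensor_eval b y) -> x = y.
Proof.
move=> h; rewrite -(tensor_reprK x) -(tensor_reprK y).
by apply/eqmodP/asboolP.
Qed.

Lemma bilinear_sum_cat (P : lmodType R) (b : M -> N -> P) s t :
  bilinear_sum b (s ++ t) = bilinear_sum b s + bilinear_sum b t.
Proof. by rewrite /bilinear_sum big_cat. Qed.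

Lemma bilinear0l (P : lmodType R) (b : M -> N -> P) n :
  is_bilinear b -> b 0 n = 0.
Proof.
by case=> + _ => /(_ n (-1) 0 0) /=; rewrite scaler0 addr0 scaleN1r addNr.
Qed.

Lemma bilinear0r (P : lmodType R) (b : M -> N -> P) m :
  is_bilinear b -> b m 0 = 0.
Proof.
by case=> _ /(_ m (-1) 0 0) /=; rewrite scaler0 addr0 scaleN1r addNr.
Qed.

Lemma bilinearZl (P : lmodType R) (b : M -> N -> P) a m n :
  is_bilinear b -> b (a *: m) n = a *: b m n.
Proof.
move=> hb; have /= := hb.1 n a m 0.
by rewrite addr0 (bilinear0l n hb) addr0.
Qed.

Lemma tensor_evalD (P : lmodType R) (b : M -> N -> P) x y :
  is_bilinear b ->
  tensor_eval b (tensor_add x y) = tensor_eval b x + tensor_eval b y.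
Proof. by move=> hb; rewrite tensor_eval_class // bilinear_sum_cat. Qed.

Lemma tensor_evalZ (P : lmodType R) (b : M -> N -> P) a x :
  is_bilinear b -> tensor_eval b (tensor_scale a x) = a *: tensor_eval b x.
Proof.
move=> hb; rewrite tensor_eval_class // /tensor_eval /bilinear_sum big_map.
by rewrite scaler_sumr; apply: eq_bigr => p _; rewrite bilinearZl.
Qed.

Lemma tensor_eval0 (P : lmodType R) (b : M -> N -> P) :
  is_bilinear b -> tensor_eval b (tensor_class [::]) = 0.
Proof. by move=> hb; rewrite tensor_eval_class // /bilinear_sum big_nil. Qed.

Fact tensor_addA : associative tensor_add.
Proof. by move=> x y z; apply: tensor_ext => P b hb; rewrite !tensor_evalD // addrA. Qed.

Fact tensor_addC : commutative tensor_add.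
Proof. by move=> x y; apply: tensor_ext => P b hb; rewrite !tensor_evalD // addrC. Qed.

Fact tensor_add0 : left_id (tensor_class [::]) tensor_add.
Proof.
by move=> x; apply: tensor_ext => P b hb;
  rewrite tensor_evalD // tensor_eval0 // add0r.
Qed.

Fact tensor_addN :
  left_inverse (tensor_class [::]) (tensor_scale (-1)) tensor_add.
Proof.
move=> x; apply: tensor_ext => P b hb.
by rewrite tensor_evalD // tensor_evalZ // tensor_eval0 // scaleN1r addNr.
Qed.

HB.instance Definition _ := GRing.isZmodule.Build tensor
  tensor_addA tensor_addC tensor_add0 tensor_addN.

Fact tensor_scaleA a b x :
  tensor_scale a (tensor_scale b x) = tensor_scale (a * b) x.
Proof. by apply: tensor_ext => P f hf; rewrite !tensor_evalZ // scalerA. Qed.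

Fact tensor_scale1 : left_id 1 tensor_scale.
Proof. by move=> x; apply: tensor_ext => P f hf; rewrite tensor_evalZ // scale1r. Qed.

Fact tensor_scaleDr : right_distributive tensor_scale +%R.
Proof.
by move=> a x y; apply: tensor_ext => P f hf;
  rewrite !(tensor_evalD, tensor_evalZ) // scalerDr.
Qed.

Fact tensor_scaleDl x : {morph tensor_scale^~ x : a b / a + b}.
Proof.
by move=> a b; apply: tensor_ext => P f hf;
  rewrite !(tensor_evalD, tensor_evalZ) // scalerDl.
Qed.

HB.instance Definition _ := GRing.Zmodule_isLmodule.Build R tensor
  tensor_scaleA tensor_scale1 tensor_scaleDr tensor_scaleDl.

End Tensor.

Section TensorMap.
Context (R : comPzRingType) (M N N' : lmodType R) (g : {linear N -> N'}).

(* The map [M (x) g : M (x) N -> M (x) N']. *)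
Definition tensor_map (x : tensor M N) : tensor M N' :=
  tensor_class [seq (p.1, g p.2) | p <- tensor_repr x].

Lemma tensor_eval_map (P : lmodType R) (b : M -> N' -> P) x :
  is_bilinear b ->
  tensor_eval b (tensor_map x) = tensor_eval (fun m n => b m (g n)) x.
Proof. by move=> hb; rewrite tensor_eval_class // /bilinear_sum big_map. Qed.

Lemma is_bilinear_comp (P : lmodType R) (b : M -> N' -> P) :
  is_bilinear b -> is_bilinear (fun m n => b m (g n)).
Proof.
case=> hl hr; split=> [n|m a u v] /=; first exact: hl.
by rewrite linearP hr.
Qed.

Fact tensor_map_linear : linear tensor_map.
Proof.
move=> a x y; apply: tensor_ext => P b hb; have hb' := is_bilinear_comp hb.
rewrite tensor_eval_map //.
by rewrite !(tensor_evalD _ _ hb, tensor_evalD _ _ hb', tensor_evalZ _ _ hb,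
  tensor_evalZ _ _ hb', tensor_eval_map).
Qed.

HB.instance Definition _ := GRing.isLinear.Build R (tensor M N) (tensor M N')
  *:%R tensor_map tensor_map_linear.

Lemma tensor_map_class s :
  tensor_map (tensor_class s) = tensor_class [seq (p.1, g p.2) | p <- s].
Proof.
apply: tensor_ext => P b hb; have hb' := is_bilinear_comp hb.
by rewrite tensor_eval_map // !tensor_eval_class // /bilinear_sum big_map.
Qed.

Lemma tensor_map_pure m n :
  tensor_map (pure_tensor m n) = pure_tensor m (g n).
Proof. exact: tensor_map_class. Qed.

End TensorMap.

Arguments tensor_map {R} M {N N'} g x.

(** * Modules *)

Definition surjective (T T' : Type) (f : T -> T') : Prop :=
  forall y, exists x, f x = y.

Definition exact_at (R : comPzRingType) (M N P : lmodType R)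
    (f : {linear M -> N}) (g : {linear N -> P}) : Prop :=
  forall y : N, g y = 0 <-> exists x : M, f x = y.

Definition projective (R : comPzRingType) (P : lmodType R) : Prop :=
  forall (M N : lmodType R) (e : {linear M -> N}) (f : {linear P -> N}),
    surjective e -> exists g : {linear P -> M}, forall x, e (g x) = f x.

Definition injective_module (R : comPzRingType) (J : lmodType R) : Prop :=
  forall (M N : lmodType R) (i : {linear M -> N}) (f : {linear M -> J}),
    injective i -> exists g : {linear N -> J}, forall x, g (i x) = f x.

Definition flat (R : comPzRingType) (F : lmodType R) : Prop :=
  forall (M N : lmodType R) (i : {linear M -> N}),
    injective i -> injective (tensor_map F i).

(* A projective resolution ... -> P 1 -> P 0 -> M -> 0 with P n = 0 for d < n. *)
Definition proj_dim_le (R : comPzRingType) (d : nat) (M : lmodType R) : Prop :=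
  exists (P : nat -> lmodType R)
         (delta : forall n, {linear P n.+1 -> P n})
         (eps : {linear P 0%N -> M}),
    [/\ forall n, projective (P n),
        forall n, (d < n)%N -> forall x : P n, x = 0,
        surjective eps,
        exact_at (delta 0%N) eps
      & forall n, exact_at (delta n.+1) (delta n)].

Definition perfect (d : nat) (R : comPzRingType) : Prop :=
  forall F : lmodType R, flat F -> proj_dim_le d F.

Definition finitely_generated (R : comPzRingType) (M : lmodType R) : Prop :=
  exists (n : nat) (g : {linear 'rV[R]_n -> M}), surjective g.

Definition finitely_presented (R : comPzRingType) (M : lmodType R) : Prop :=
  exists (m n : nat) (f : {linear 'rV[R]_m -> 'rV[R]_n})
         (g : {linear 'rV[R]_n -> M}), surjective g /\ exact_at f g.

(* Ideals of R are the modules that embed into R. *)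
Definition coherent (R : comPzRingType) : Prop :=
  forall (J : lmodType R) (i : {linear J -> R^o}),
    injective i -> finitely_generated J -> finitely_presented J.

(** * Complexes *)

Record complex (R : comPzRingType) := Complex {
  cterm :> int -> lmodType R;
  cdiff : forall n : int, {linear cterm n -> cterm (n - 1)};
  cdiff_cdiff : forall (n : int) (x : cterm n), cdiff (n - 1) (cdiff n x) = 0 }.

Arguments cdiff {R} c n.

(* Exactness at the term of degree n - 1, which avoids a cast from degree     *)
(* n + 1 - 1 to degree n.                                                     *)
Definition acyclic (R : comPzRingType) (C : complex R) : Prop :=
  forall n : int, exact_at (cdiff C n) (cdiff C (n - 1)).

(* Exactness of Hom(C_(n-1-1), Q) -> Hom(C_(n-1), Q) -> Hom(C_n, Q) for all n. *)
Definition Hom_acyclic (R : comPzRingType) (C : complex R) (Q : lmodType R) :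
    Prop :=
  forall (n : int) (g : {linear C (n - 1) -> Q}),
    (forall x, g (cdiff C n x) = 0) <->
    exists h : {linear C (n - 1 - 1) -> Q}, forall y, h (cdiff C (n - 1) y) = g y.

Lemma tensor_diff_diff (R : comPzRingType) (J : lmodType R) (C : complex R)
    (n : int) (x : tensor J (C n)) :
  tensor_map J (cdiff C (n - 1)) (tensor_map J (cdiff C n) x) = 0.
Proof.
apply: tensor_ext => P b hb; rewrite !tensor_eval_map //; last first.
  exact: is_bilinear_comp.
rewrite tensor_eval0 // /tensor_eval /bilinear_sum big1 // => p _ /=.
by rewrite cdiff_cdiff bilinear0r.
Qed.

Definition tensor_complex (R : comPzRingType) (J : lmodType R)
    (C : complex R) : complex R :=
  @Complex R (fun n => tensor J (C n)) (fun n => tensor_map J (cdiff C n))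
    (@tensor_diff_diff R J C).

Definition totally_acyclic (R : comPzRingType) (P : complex R) : Prop :=
  [/\ forall n, projective (P n), acyclic P
    & forall Q : lmodType R, projective Q -> Hom_acyclic P Q].

Definition F_totally_acyclic (R : comPzRingType) (F : complex R) : Prop :=
  [/\ forall n, flat (F n), acyclic F
    & forall J : lmodType R, injective_module J ->
        acyclic (tensor_complex J F)].

(** * Prime spectra *)

Definition is_prime_ideal (A : comPzRingType) (p : set A) : Prop :=
  [/\ p 0,
      forall a b, p a -> p b -> p (a + b),
      forall a b, p b -> p (a * b),
      ~ p 1
    & forall a b, p (a * b) -> p a \/ p b].

Record spec (A : comPzRingType) := Spec {
  prime_ideal :> set A;
  prime_idealP : is_prime_ideal prime_ideal }.

HB.instance Definition _ (A : comPzRingType) := gen_eqMixin (spec A).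
HB.instance Definition _ (A : comPzRingType) := gen_choiceMixin (spec A).

Definition distinguished (A : comPzRingType) (f : A) : set (spec A) :=
  [set p : spec A | ~ prime_ideal p f].

Definition zariski_open (A : comPzRingType) (W : set (spec A)) : Prop :=
  forall p, W p -> exists2 f : A, distinguished f p & distinguished f `<=` W.

Fact zariski_openT (A : comPzRingType) : @zariski_open A setT.
Proof. by move=> p _; exists 1; first by case: (prime_idealP p). Qed.

Fact zariski_openI (A : comPzRingType) : setI_closed (@zariski_open A).
Proof.
move=> V W hV hW p [/hV[f fp fV] /hW[g gp gW]]; exists (f * g).
  by case: (prime_idealP p) => _ _ _ _ h /h[].
move=> q /= fgq; case: (prime_idealP q) => _ _ hM _ _; split.
- by apply: fV => /= fq; apply: fgq; rewrite mulrC; exact: hM.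
- by apply: gW => /= gq; apply: fgq; exact: hM.
Qed.

Fact zariski_open_bigU (A : comPzRingType) (I : Type)
    (W : I -> set (spec A)) :
  (forall i, zariski_open (W i)) -> zariski_open (\bigcup_i W i).
Proof.
move=> hW p [i _ /hW[f fp fW]]; exists f => // q /fW Wq.
by exists i.
Qed.

HB.instance Definition _ (A : comPzRingType) :=
  isOpenTopological.Build (spec A) (@zariski_openT A) (@zariski_openI A)
    (@zariski_open_bigU A).

Lemma spec_openE (A : comPzRingType) : @open (spec A) = @zariski_open A.
Proof. by []. Qed.

(** * Ringed spaces and schemes *)

Record opens (X : topologicalType) := Opens {
  carrier :> set X;
  carrier_open : open carrier }.

Definition opensI (X : topologicalType) (U V : opens X) : opens X :=
  Opens (openI (carrier_open U) (carrier_open V)).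

Definition is_sheaf (X : topologicalType) (F : opens X -> Type)
    (r : forall U V : opens X, V `<=` U -> F U -> F V) : Prop :=
  [/\ forall (U : opens X) (h : U `<=` U) (s : F U), r U U h s = s,
      forall (U V W : opens X) (hVU : V `<=` U) (hWV : W `<=` V)
             (hWU : W `<=` U) (s : F U),
        r U W hWU s = r V W hWV (r U V hVU s)
    & forall (U : opens X) (I : Type) (V : I -> opens X)
             (hV : forall i, V i `<=` U),
        U = \bigcup_i V i :> set X ->
        forall s : forall i, F (V i),
        (forall i j,
           r (V i) (opensI (V i) (V j)) (@subIsetl _ _ _) (s i) =
           r (V j) (opensI (V i) (V j)) (@subIsetr _ _ _) (s j)) ->
        exists! t : F U, forall i, r U (V i) (hV i) t = s i].

Record ringed_space := RingedSpace {
  space :> topologicalType;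
  OX : opens space -> comPzRingType;
  res : forall U V : opens space, V `<=` U -> {rmorphism OX U -> OX V};
  OX_sheaf : is_sheaf (fun U V h => res h : OX U -> OX V) }.

Arguments OX {r} U.
Arguments res {r U V} h.

(* B is the localization of A at the powers of f. *)
Definition is_localization (A B : comPzRingType) (f : A)
    (nu : {rmorphism A -> B}) : Prop :=
  [/\ exists b, nu f * b = 1,
      forall b, exists (k : nat) (a : A), nu f ^+ k * b = nu a
    & forall a, nu a = 0 -> exists k : nat, f ^+ k * a = 0].

(* An isomorphism of ringed spaces from Spec A onto the open subspace U. The  *)
(* structure sheaf of Spec A is the sheaf whose ring of sections over the     *)
(* basic open set D(f) is A_f, and an isomorphism of sheaves is determined by *)
(* the basic open sets. For f = 1 the last clause says that theta is          *)
(* bijective.                                                                 *)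
Record affine_chart (X : ringed_space) (U : opens X) (A : comPzRingType)
    (psi : spec A -> X) (theta : {rmorphism A -> OX U}) : Prop := AffineChart {
  chart_inj : injective psi;
  chart_range : range psi = U;
  chart_continuous : continuous psi;
  chart_open : forall W : set (spec A), open W -> open (psi @` W);
  chart_sections : forall (f : A) (V : opens X) (h : V `<=` U),
    V = psi @` distinguished f :> set X ->
    is_localization f (res h \o theta) }.

Definition affine (X : ringed_space) (U : opens X) : Prop :=
  exists (A : comPzRingType) (psi : spec A -> X)
         (theta : {rmorphism A -> OX U}), affine_chart psi theta.

(* Local rings come for free: stalks of Spec A are localizations of A. *)
Record scheme := Scheme {
  scheme_space :> ringed_space;
  scheme_affine : forall x : scheme_space,
    exists2 U : opens scheme_space, affine U & carrier U x }.

Definition locally_coherent (X : scheme) : Prop :=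
  forall U : opens X, affine U -> coherent (OX U).

Definition locally_perfect (d : nat) (X : scheme) : Prop :=
  forall U : opens X, affine U -> perfect d (OX U).

Definition affine_covering (X : scheme) (C : set (opens X)) : Prop :=
  (forall U, C U -> affine U) /\ (forall x : X, exists2 U, C U & carrier U x).

(** * Sheaves of modules *)

Record module_sheaf (X : ringed_space) := ModuleSheaf {
  msec :> forall U : opens X, lmodType (OX U);
  mres : forall (U V : opens X) (h : V `<=` U),
    {linear msec U -> msec V | res h \; *:%R};
  module_sheafP : is_sheaf (fun U V h => mres h : msec U -> msec V) }.

Arguments mres {X} m {U V} h.

Record sheaf_morphism (X : ringed_space) (M N : module_sheaf X) :=
  SheafMorphism {
    smap :> forall U : opens X, {linear M U -> N U};
    smap_res : forall (U V : opens X) (h : V `<=` U) (s : M U),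
      smap V (mres M h s) = mres N h (smap U s) }.

(* N is the localization of the R-module M at the powers of s. *)
Definition is_module_localization (R S : comPzRingType)
    (nu : {rmorphism R -> S}) (M : lmodType R) (N : lmodType S) (s : R)
    (rho : {linear M -> N | nu \; *:%R}) : Prop :=
  [/\ exists b, nu s * b = 1,
      forall y : N, exists (k : nat) (x : M), nu s ^+ k *: y = rho x
    & forall x : M, rho x = 0 -> exists k : nat, s ^+ k *: x = 0].

(* On each affine open U = Spec A, the sheaf M is the one associated with the *)
(* module M(U): its module of sections over each D(f) is M(U)_f.              *)
Definition quasi_coherent (X : ringed_space) (M : module_sheaf X) : Prop :=
  forall (U : opens X) (A : comPzRingType) (psi : spec A -> X)
         (theta : {rmorphism A -> OX U}), affine_chart psi theta ->
  forall (f : A) (V : opens X) (h : V `<=` U),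
    V = psi @` distinguished f :> set X ->
    is_module_localization (theta f) (mres M h).

Definition vector_bundle (X : scheme) (P : module_sheaf X) : Prop :=
  quasi_coherent P /\ forall U : opens X, affine U -> projective (P U).

Definition flat_quasi_coherent (X : scheme) (F : module_sheaf X) : Prop :=
  quasi_coherent F /\ forall U : opens X, affine U -> flat (F U).

Record sheaf_complex (X : ringed_space) := SheafComplex {
  sterm :> int -> module_sheaf X;
  sdiff : forall n : int, sheaf_morphism (sterm n) (sterm (n - 1));
  sdiff_sdiff : forall (n : int) (U : opens X) (x : sterm n U),
    sdiff (n - 1) U (sdiff n U x) = 0 }.

Arguments sdiff {X} s n.

Definition sections (X : ringed_space) (C : sheaf_complex X) (U : opens X) :
    complex (OX U) :=
  @Complex (OX U) (fun n => C n U) (fun n => sdiff C n U)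
    (fun n => @sdiff_sdiff X C n U).

Definition F_totally_acyclic_sheaves (X : scheme) (F : sheaf_complex X) :
    Prop :=
  (forall n, flat_quasi_coherent (F n)) /\
  (forall U : opens X, affine U -> F_totally_acyclic (sections F U)).

(* Main.v *)
From HB Require Import structures.
Require Import Defs.
From mathcomp Require Import all_boot all_order all_algebra.
From mathcomp Require Import ring zify.
From mathcomp Require Import boolp classical_sets functions topology.

(* The total acyclicity of P over an affine U of the covering only says that  *)
(* Hom(P(U), Q) is exact for Q projective; since flat modules over O(U) have  *)
(* finite projective dimension, it is exact for every flat Q.                 *)
(* Let V be an arbitrary affine open set, A = O(V), and J an injective        *)
(* A-module. If J (x) P(V) had a cycle z which is not a boundary, then        *)
(* {a | a z is a boundary} would lie in a prime ideal, that is, in a point x  *)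
(* of V. Choose U in the covering containing x, and W containing x which is   *)
(* a distinguished open set of V, W = D(f), and of U. Embed the cokernel of   *)
(* the differential into an injective A-module E, so that lam : J (x) P(V)    *)
(* -> E kills exactly the boundaries. Then lam is a map P(V) -> F where       *)
(* F = Hom_A(J, E) is flat because A is coherent, and it yields a map         *)
(* P(U) -> F_f of O(U)-modules, with F_f flat over O(U). This map extends     *)
(* along the differential of P(U), so lam(z) vanishes in E_f: a multiple      *)
(* f^k z is a boundary, contrary to the choice of x. It matters to localize   *)
(* Hom_A(J, E) and not J, since J_f need not be injective when A is merely    *)
(* coherent.                                                                  *)

Set Implicit Arguments.
Unset Strict Implicit.
Unset Printing Implicit Defensive.

Import GRing.Theory Num.Theory.

Local Open Scope classical_set_scope.
Local Open Scope ring_scope.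
Local Open Scope quotient_scope.

(** A cycle [z] is a boundary once the ideal of all [a] with [a z] a boundary contains 1. By
    [affine_local] it suffices that this ideal contains a power of [f] for each distinguished open
    set [D(f)] shared with a member of the covering. For plain acyclicity, [local_boundary] clears
    denominators. For [J (x) P] the question is moved to Hom: testing against an injective [E], a
    map [J (x) P -> E] is a map [P -> Hom(J, E)]. This target is flat over a coherent ring
    ([coherent_homs_flat]), and flatness survives localization at [f] and restriction to the other
    ring ([equationally_flat_localization], [equationally_flat_restriction]). Over a [d]-perfect
    ring, Hom from a totally acyclic complex into a flat module is exact by dimension shifting
    ([proj_dim_Hom_acyclic]). [local_tensor_vanishing] combines these facts; termwise flatness is
    [projective_flat]. *)

Definition pack_linear (R : pzRingType) (M : lmodType R) (N : zmodType)
    (s : GRing.Scale.law R N) (f : M -> N) (hf : linear_for s f) :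
    {linear M -> N | s} :=
  HB.pack f (GRing.isLinear.Build R M N s f hf).

(** * Submodules and partial linear maps *)

(** Membership is a [Prop], so that images, kernels and graphs described by existential statements
    qualify directly; [subcarrier] turns them into modules. *)
Record submodule (R : pzRingType) (M : lmodType R) := Submodule {
  submem :> M -> Prop;
  submemP : submem 0 /\
    forall a x y, submem x -> submem y -> submem (a *: x + y) }.

Section SubmoduleTheory.
Context (R : pzRingType) (M : lmodType R) (S : submodule M).

Definition submemb : {pred M} := fun x => `[< S x >].

Fact submemb_closed : submod_closed submemb.
Proof.
case: (submemP S) => S0 SP; split=> [|a x y /asboolP Sx /asboolP Sy].
  exact/asboolP.
by apply/asboolP; exact: SP.
Qed.

HB.instance Definition _ := GRing.isSubmodClosed.Build R M submemb
  (GRing.submod_closed_semi submemb_closed).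

Record subcarrier := Subcarrier {
  subval : M;
  _ : subval \in submemb }.

HB.instance Definition _ := [isSub for subval].
HB.instance Definition _ := [Choice of subcarrier by <:].
HB.instance Definition _ := [SubChoice_isSubLmodule of subcarrier by <:].

End SubmoduleTheory.
(* Partial linear maps N -> J are represented by their graphs. *)
Definition functional (R : pzRingType) (N J : lmodType R)
    (G : submodule (N * J)%type) : Prop := forall x, G (0, x) -> x = 0.

(* Injectivity, phrased for submodules in place of injective maps. *)
Definition extensible (R : pzRingType) (J : lmodType R) : Prop :=
  forall (N : lmodType R) (G : submodule (N * J)%type), functional G ->
  exists g : {linear N -> J}, forall y x, G (y, x) -> x = g y.

(** The hypothesis of Baer's criterion: a functional graph over [R^o] is a linear map from an ideal
    to [J], and it must have the form [a |-> a *: j]. *)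
Definition baer (R : pzRingType) (J : lmodType R) : Prop :=
  forall G : submodule (R^o * J)%type, functional G ->
  exists j : J, forall (a : R) x, G (a, x) -> x = a *: j.

Section SubmoduleClosure.
Context (R : pzRingType) (M : lmodType R) (S : submodule M).

Lemma submem0 : S 0. Proof. by case: (submemP S). Qed.

Lemma submemP2 a x y : S x -> S y -> S (a *: x + y).
Proof. by case: (submemP S) => _; exact. Qed.

Lemma submemZ a x : S x -> S (a *: x).
Proof. by move=> Sx; rewrite -[_ *: _]addr0; apply: submemP2 => //; exact: submem0. Qed.

Lemma submemD x y : S x -> S y -> S (x + y).
Proof. by move=> Sx Sy; rewrite -[x]scale1r; exact: submemP2. Qed.

Lemma submemB x y : S x -> S y -> S (x - y).
Proof. by move=> Sx Sy; rewrite addrC -scaleN1r; exact: submemP2. Qed.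

Lemma submem_sum (I : Type) (s : seq I) (F : I -> M) :
  (forall i, S (F i)) -> S (\sum_(i <- s) F i).
Proof.
move=> SF; elim: s => [|i s IH]; first by rewrite big_nil; exact: submem0.
by rewrite big_cons; exact: submemD.
Qed.

End SubmoduleClosure.

(** Zorn's lemma, for maximal partial maps in [baer_extend] and for maximal ideals in
    [prime_ideal_above]. *)
Lemma submodule_max (R : pzRingType) (M : lmodType R) (Q : M -> Prop)
    (G : submodule M) :
  (forall u, G u -> Q u) -> exists H : submodule M,
    [/\ forall u, H u -> Q u, forall u, G u -> H u
      & forall K : submodule M, (forall u, K u -> Q u) ->
          (forall u, H u -> K u) -> forall u, K u -> H u].
Proof.
move=> GQ.
(* The empty set is admitted as the union of the empty chain. *)
pose good (X : set M) := exists H : submodule M,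
  [/\ forall u, H u -> Q u, forall u, G u -> H u & X = H :> set _ \/ X = set0].
have [|Y [goodY maxY]] := @Zorn_bigcup _ good.
  move=> F Fgood Ftot.
  have [->|/set0P[u0 [X0 FX0 X0u0]]] := eqVneq (\bigcup_(X in F) X) set0.
    by exists G; split=> //; right.
  have memF X u : F X -> X u -> exists H : submodule M,
      [/\ forall v, H v -> Q v, forall v, G v -> H v & X = H :> set _].
    move=> FX Xu; have [H [HQ GH [XH|XE]]] := Fgood _ FX; first by exists H.
    by rewrite XE in Xu.
  have [H0 [_ GH0 X0H0]] := memF _ _ FX0 X0u0.
  have U0 : (\bigcup_(X in F) X) 0.
    by exists X0 => //; rewrite X0H0; exact: submem0.
  have UP a x y : (\bigcup_(X in F) X) x -> (\bigcup_(X in F) X) y ->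
      (\bigcup_(X in F) X) (a *: x + y).
    move=> [X FX Xx] [Y FY Yy].
    have [XY|YX] := Ftot _ _ FX FY.
      exists Y => //; have [H [_ _ YH]] := memF _ _ FY Yy.
      by rewrite YH; apply: submemP2; rewrite -YH //; exact: XY.
    exists X => //; have [H [_ _ XH]] := memF _ _ FX Xx.
    by rewrite XH; apply: submemP2; rewrite -XH //; exact: YX.
  exists (Submodule (conj U0 UP)); split=> [u [X FX Xu]|u Gu|]; last by left.
    by have [H [HQ _ XH]] := memF _ _ FX Xu; apply: HQ; rewrite -XH.
  by exists X0 => //; rewrite X0H0; exact: GH0.
have [H [HQ GH YH]] := goodY.
have {}YH : Y = H.
  case: YH => // Y0; exfalso; apply: (maxY H); last by exists H; split=> //; left.
  rewrite Y0; split=> [u []|/(_ 0)]; apply; exact: submem0.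
exists H; split=> // K KQ HK u Ku; apply: contrapT => nHu.
apply: (maxY K); last by exists K; split=> //; [move=> v /GH/HK|left].
by rewrite YH; split=> [|/(_ u Ku)].
Qed.

(** * Baer's criterion *)

Section Baer.
Context (R : pzRingType) (N J : lmodType R).

Lemma functional_uniq (G : submodule (N * J)%type) y x x' :
  functional G -> G (y, x) -> G (y, x') -> x = x'.
Proof.
move=> fG Gx Gx'; apply/eqP; rewrite -subr_eq0; apply/eqP/fG.
by rewrite -(subrr y); exact: (submemB Gx Gx').
Qed.

(** A maximal graph [H] is total: on the ideal of all [a] with [a *: y] in its domain, [H] is
    [a |-> a *: j], so adjoining [(y, j)] keeps it functional. *)
Lemma baer_extend : baer J -> forall G : submodule (N * J)%type,
  functional G -> exists g : {linear N -> J}, forall y x, G (y, x) -> x = g y.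
Proof.
move=> bJ G fG.
have [|H [HQ GH maxH]] := @submodule_max _ _ (fun u => u.1 = 0 -> u.2 = 0) G.
  by move=> [y x] Gyx /= y0; apply: fG; rewrite -y0.
have fH : functional H by move=> x /HQ; apply.
have total y : exists x, H (y, x).
  have I0 : H ((0 : R) *: y, 0) by rewrite scale0r; exact: submem0.
  have IP (a : R) (u v : R^o * J) : H ((u.1 : R) *: y, u.2) ->
      H ((v.1 : R) *: y, v.2) ->
      H (((a *: u + v).1 : R) *: y, (a *: u + v).2).
    move=> Hu Hv; rewrite /= scalerDl -scalerA.
    exact: (submemP2 a Hu Hv).
  pose I := @Submodule R (R^o * J)%type
    (fun u => H ((u.1 : R) *: y, u.2)) (conj I0 IP).
  have fI : functional I by move=> x; rewrite /I /= scale0r; exact: fH.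
  have [j Ij] := bJ I fI.
  exists j.
  pose K (u : N * J) := exists a v, H v /\ u = v + a *: (y, j).
  have K0 : K 0.
    by exists 0, 0; split; [exact: submem0|rewrite scale0r addr0].
  have KP a u v : K u -> K v -> K (a *: u + v).
    move=> [b [u' [Hu ->]]] [c [v' [Hv ->]]].
    exists (a * b + c), (a *: u' + v'); split; first exact: submemP2.
    by rewrite scalerDr addrACA scalerA -scalerDl.
  have KQ u : Submodule (conj K0 KP) u -> u.1 = 0 -> u.2 = 0.
    move=> [a [[y' x'] [Hv ->]]] /= y'E.
    have /Ij : I (- a, x').
      suff y'a : y' = - a *: y by rewrite y'a in Hv.
      by apply/eqP; rewrite scaleNr -addr_eq0 y'E.
    by move=> ->; rewrite scaleNr addNr.
  apply: (maxH _ KQ) => [u Hu|]; last first.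
    by exists 1, 0; rewrite add0r scale1r; split=> //; exact: submem0.
  by exists 0, u; rewrite scale0r addr0.
pose g y := xget 0 [set x | H (y, x)].
have Hg y : H (y, g y) by rewrite /g; case: xgetP => // no; have [x] := total y; move/no.
have g_lin : linear g.
  by move=> a x y; apply: (functional_uniq fH (Hg _)); exact: (submemP2 a (Hg x) (Hg y)).
by exists (pack_linear g_lin) => y x /GH Hyx; exact: (functional_uniq fH Hyx).
Qed.

End Baer.

Lemma baer_extensible (R : pzRingType) (J : lmodType R) :
  baer J -> extensible J.
Proof. by move=> bJ N; exact: baer_extend. Qed.

Lemma injective_extensible (R : comPzRingType) (J : lmodType R) :
  injective_module J -> extensible J.
Proof.
move=> iJ N G fG.
have p1_lin : linear (fun u : subcarrier G => (\val u).1) by move=> a u v; rewrite linearP.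
have p2_lin : linear (fun u : subcarrier G => (\val u).2) by move=> a u v; rewrite linearP.
have p1_inj : injective (pack_linear p1_lin).
  move=> u v uv; have {}uv : (\val u).1 = (\val v).1 := uv.
  apply: val_inj.
  have /asboolP Gu := valP u; have /asboolP Gv := valP v.
  move: uv Gu Gv; case: (\val u) (\val v) => [y x] [y' x'] /= -> Gx Gx'.
  by rewrite (functional_uniq fG Gx Gx').
have [g gP] := iJ _ _ _ (pack_linear p2_lin) p1_inj.
exists g => y x Gyx; have yxP : (y, x) \in submemb G by exact/asboolP.
exact: esym (gP (Subcarrier yxP)).
Qed.

Lemma extensible_injective (R : comPzRingType) (J : lmodType R) :
  extensible J -> injective_module J.
Proof.
move=> eJ M N i f i_inj.
have G0 : exists m, (0 : N * J) = (i m, f m) by exists 0; rewrite !linear0.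
have GP a (u v : N * J) : (exists m, u = (i m, f m)) ->
    (exists m, v = (i m, f m)) -> exists m, a *: u + v = (i m, f m).
  by move=> [m ->] [m' ->]; exists (a *: m + m'); rewrite !linearP.
have [|g gP] := eJ N (@Submodule _ (N * J)%type _ (conj G0 GP)).
  move=> x [m [im ->]]; suff -> : m = 0 by rewrite linear0.
  by apply: i_inj; rewrite -im linear0.
by exists g => m; rewrite -(gP (i m) (f m)) //; exists m.
Qed.

(** * Enough injective modules *)

Definition int_rat : {pred rat} := fun q => q \is a Num.int.

Fact int_rat_closed : zmod_closed int_rat.
Proof. by have [] := @int_num_subring rat; split=> //; exact: int_num0. Qed.

HB.instance Definition _ := GRing.isZmodClosed.Build rat int_rat int_rat_closed.

Local Notation QZquot := (Quotient.quot int_rat).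

Definition QZ : Type := zmodule QZquot.
HB.instance Definition _ := GRing.Lmodule.on QZ.

Definition piQZ (q : rat) : QZ := \pi_QZquot q.

Lemma piQZ_lin n q : piQZ (q *~ n) = n *: piQZ q.
Proof. by rewrite /piQZ raddfMz. Qed.

Lemma piQZ_surj (x : QZ) : exists q, x = piQZ q.
Proof. by exists (repr (x : QZquot)); rewrite /piQZ reprK. Qed.

Lemma piQZ_eq0 q : piQZ q = 0 <-> q \is a Num.int.
Proof.
have -> : (q \is a Num.int) = (q - 0 \in int_rat) by rewrite subr0.
rewrite Quotient.idealrBE -[\pi 0]/(piQZ 0) (_ : piQZ 0 = 0); last exact: raddf0.
by split=> /eqP.
Qed.

Lemma QZ_divisible (n : int) (x : QZ) : n != 0 -> exists y, x = n *: y.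
Proof.
move=> n0; have [q ->] := piQZ_surj x; exists (piQZ (q / n%:~R)).
by rewrite -piQZ_lin -mulrzr divfK // intr_eq0.
Qed.

(* The order of y modulo S, with the value 2 in case of infinite order. *)
Lemma int_submodule_gen (M : lmodType int) (S : submodule M) y : ~ S y ->
  exists2 n : nat, (1 < n)%N & forall m : int, S (m *: y) -> (n%:Z %| m)%Z.
Proof.
move=> nSy.
have [[n0 Sn0]|noS] := pselect (exists n, (0 < n)%N && `[< S (n%:Z *: y) >]).
  have Hex : exists n, (0 < n)%N && `[< S (n%:Z *: y) >] by exists n0.
  case: (ex_minnP Hex) => n /andP[n_gt0 /asboolP Sn] nmin; exists n.
    rewrite ltn_neqAle n_gt0 andbT eq_sym; apply/eqP => n1.
    by rewrite n1 scale1r in Sn.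
  move=> m Sm; apply/dvdz_mod0P; set r := (m %% n)%Z.
  have Sr : S (r *: y).
    suff -> : r *: y = m *: y - (m %/ n)%Z *: (n%:Z *: y).
      by apply: submemB => //; exact: submemZ.
    by rewrite scalerA -scalerBl [X in X - _](divz_eq m n) addrAC subrr add0r.
  have r_ge0 : 0 <= r by rewrite modz_ge0 // (eqz_nat _ 0) -lt0n.
  have r_ltn : r < n by rewrite ltz_pmod.
  move: r_ge0 r_ltn Sr; case: (r) => [[|k]|k] // _ k_ltn Sk.
  have := nmin k.+1; rewrite /= leqNgt => /(_ _)/negP; case => //.
  exact/asboolP.
exists 2%N => // m Sm; suff -> : m = 0 by rewrite dvdz0.
apply/eqP/negPn/negP => m0; apply: noS; exists `|m|%N; rewrite absz_gt0 m0 /=.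
apply/asboolP; rewrite abszE; case: (ger0P m) => _ //.
by rewrite scaleNr -scaleN1r; exact: submemZ.
Qed.


(** A nonzero ideal of Z is generated by its least positive element [n], and the value of the
    partial map at [n] can be divided by [n]. *)
Lemma QZ_baer : baer QZ.
Proof.
move=> G fG.
pose p (n : nat) := (0 < n)%N && `[< exists x, G (n%:Z, x) >].
have [Hex|noG] := pselect (exists n, p n); last first.
  exists 0 => a x Gax; rewrite scaler0; apply: fG.
  suff a0 : a = 0 by rewrite a0 in Gax.
  apply/eqP/negPn/negP => a0; apply: noG; exists `|a|%N.
  rewrite /p absz_gt0 a0 /=; apply/asboolP; rewrite abszE.
  case: (ger0P (a : int)) => _; first by exists x.
  exists (- x); have := submemZ (-1) Gax.
  by rewrite scaleN1r.
case: (ex_minnP Hex) => n /andP[n_gt0 /asboolP[x Gnx]] nmin.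
have [|j xE] := @QZ_divisible n x; first by rewrite (eqz_nat _ 0) -lt0n.
exists j => a y Gay.
set r := (a %% n)%Z.
have Gr : G (r, y - (a %/ n)%Z *: x).
  have -> : (r, y - (a %/ n)%Z *: x) = (a, y) - (a %/ n)%Z *: ((n%:Z : int^o), x).
    suff rE : r = (a : int) - (a %/ n)%Z * n by rewrite rE.
    by rewrite [X in X - _](divz_eq a n) addrAC subrr add0r.
  by apply: submemB => //; exact: submemZ.
have r_ge0 : 0 <= r by rewrite modz_ge0 // (eqz_nat _ 0) -lt0n.
have r_ltn : r < n by rewrite ltz_pmod.
have r0 : r = 0.
  move: r_ge0 r_ltn Gr; case: (r) => [[|k]|k] // _ k_ltn Gk.
  have := nmin k.+1; rewrite leqNgt => /(_ _)/negP; case => //.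
  by apply/andP; split=> //; apply/asboolP; exists (y - (a %/ n)%Z *: x).
move: Gr; rewrite r0 => /fG/eqP; rewrite subr_eq0 => /eqP ->.
rewrite xE scalerA; congr (_ *: _).
by rewrite [RHS](divz_eq a n) -/r r0 addr0.
Qed.

(** If [n > 1] divides every [m] with [m *: y] in [S], then sending [y] to the class of 1/n and [S]
    to 0 is well defined on [S + Z y]; injectivity of Q/Z extends it. *)
Lemma QZ_separates (M : lmodType int) (S : submodule M) y : ~ S y ->
  exists2 chi : {linear M -> QZ}, (forall x, S x -> chi x = 0) & chi y != 0.
Proof.
move=> nSy; have [n n_gt1 nP] := int_submodule_gen nSy.
pose c := piQZ n%:R^-1.
have nQ0 : (n%:R : rat) != 0 by rewrite pnatr_eq0 -lt0n ltnW.
have cn m : (n%:Z %| m)%Z -> m *: c = 0.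
  move=> /dvdzP[k ->]; rewrite -piQZ_lin; apply/piQZ_eq0.
  rewrite mulrC mulrzA -[_ *~ n%:Z]mulrzr mulVf //.
have c_neq0 : c != 0.
  apply/eqP => /piQZ_eq0/intrP[k nk].
  have : (1 : rat) = (n%:Z * k)%:~R by rewrite intrM -nk divff.
  move/eqP; rewrite -[1]/(1%:~R) eqr_int => /eqP /(congr1 absz).
  rewrite abszM => /esym/eqP; rewrite muln_eq1 => /andP[/eqP n1].
  by move: n_gt1; rewrite -[n]absz_nat n1.
clearbody c.
pose K (u : M * QZ) := exists x m, S x /\ u = (x + m *: y, m *: c).
have K0 : K 0.
  by exists 0, 0; split; [exact: submem0|rewrite !scale0r addr0].
have KP a u v : K u -> K v -> K (a *: u + v).
  move=> [x [m [Sx ->]]] [x' [m' [Sx' ->]]].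
  exists (a *: x + x'), (a * m + m'); split; first exact: submemP2.
  have <- : a *: (x + m *: y) + (x' + m' *: y)
            = a *: x + x' + (a * m + m') *: y.
    by rewrite scalerDr scalerDl scalerA addrACA.
  by rewrite [(_ + _) *: c]scalerDl -scalerA.
have [|chi chiP] := baer_extensible QZ_baer (G := Submodule (conj K0 KP)).
  move=> z [x [m [Sx]]] [/esym/eqP]; rewrite addrC addr_eq0 => /eqP my ->.
  by apply/cn/nP; rewrite my -scaleN1r; exact: submemZ.
exists chi => [x Sx|].
  by rewrite -(chiP x 0) //; exists x, 0; rewrite !scale0r addr0.
rewrite -(chiP y c) //.
by exists 0, 1; rewrite !scale1r add0r; split=> //; exact: submem0.
Qed.

(** * The character module of a ring is injective *)

Section CharacterModule.
Context (R : comPzRingType).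

Definition additive_map (chi : R -> QZ) : Prop :=
  linear (chi : zmodule R -> QZ).

Fact additive_map_closed : additive_map 0 /\
  forall a chi psi, additive_map chi -> additive_map psi ->
    additive_map (a *: chi + psi).
Proof.
split=> [n x y|n f g hf hg m x y]; first by rewrite scaler0 addr0.
rewrite /= !(fctE, scalrfctE) hf hg !scalerDr !scalerA (mulrC n m).
by rewrite addrACA.
Qed.

(* Hom_Z(R, Q/Z) *)
Definition character : Type := subcarrier (Submodule additive_map_closed).
HB.instance Definition _ := GRing.Zmodule.on character.

Definition char_val (chi : character) : R -> QZ := \val chi.

Lemma char_linear chi : linear (char_val chi : zmodule R -> QZ).
Proof. by have /asboolP := valP chi. Qed.

Lemma charD chi a b : char_val chi (a + b) = char_val chi a + char_val chi b.
Proof. by have := char_linear chi 1 a b; rewrite !scale1r. Qed.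

Lemma charD0 chi : char_val chi 0 = 0.
Proof. by apply: (addrI (char_val chi 0)); rewrite -charD !addr0. Qed.

Lemma char_inj chi psi : (forall a, char_val chi a = char_val psi a) -> chi = psi.
Proof. by move=> h; apply: val_inj; apply/funext. Qed.

Definition mk_char (f : R -> QZ) (hf : additive_map f) : character :=
  @Subcarrier _ _ (Submodule additive_map_closed) f (introT (asboolP _) hf).

Fact char_scale_additive a chi : additive_map (fun r => char_val chi (a * r)).
Proof.
move=> n x y; rewrite -char_linear; congr (char_val chi _).
by rewrite mulrDr; congr (_ + _); exact: mulrzAr.
Qed.

Definition char_scale a chi : character := mk_char (char_scale_additive a chi).

Lemma char_valZ a chi r : char_val (char_scale a chi) r = char_val chi (a * r).
Proof. by []. Qed.

Lemma char_valD chi psi r : char_val (chi + psi) r = char_val chi r + char_val psi r.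
Proof. by []. Qed.

Fact char_scaleA a b chi : char_scale a (char_scale b chi) = char_scale (a * b) chi.
Proof. by apply: char_inj => r; rewrite !char_valZ mulrCA mulrA. Qed.

Fact char_scale1 : left_id 1 char_scale.
Proof. by move=> chi; apply: char_inj => r; rewrite char_valZ mul1r. Qed.

Fact char_scaleDr : right_distributive char_scale +%R.
Proof. by move=> a chi psi; apply: char_inj. Qed.

Fact char_scaleDl chi : {morph char_scale^~ chi : a b / a + b}.
Proof.
by move=> a b; apply: char_inj => r; rewrite !(char_valZ, char_valD) mulrDl charD.
Qed.

HB.instance Definition _ := GRing.Zmodule_isLmodule.Build R character
  char_scaleA char_scale1 char_scaleDr char_scaleDl.

Lemma char_scaleE a chi r : char_val (a *: chi) r = char_val chi (a * r).
Proof. by []. Qed.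

(** Adjunction: evaluation at 1 turns linear maps into Hom_Z(R, Q/Z) into additive maps to Q/Z. The
    additive extension [t] to all of [R] is itself the character sought. *)
Lemma character_baer : baer character.
Proof.
move=> G fG.
pose H (u : zmodule R * QZ) := exists2 chi, G (u.1, chi) & u.2 = char_val chi 1.
have H0 : H 0 by exists 0 => //; exact: submem0.
have HP n u v : H u -> H v -> H (n *: u + v).
  move=> [chi Gchi uE] [psi Gpsi vE]; exists (n%:~R *: chi + psi).
    have uz : (u.1 : R) *~ n = n%:~R * u.1 by rewrite mulrzl.
    rewrite -[(n *: u + v).1]/((u.1 : R) *~ n + v.1) uz.
    exact: (submemP2 n%:~R Gchi Gpsi).
  rewrite /= uE vE char_valD char_scaleE mulr1; congr (_ + _).
  by have := char_linear chi n 1 0; rewrite charD0 !addr0 => <-.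
have [|t tP] := baer_extensible QZ_baer (G := Submodule (conj H0 HP)).
  by move=> x [chi /= /fG -> ->].
have t_add : additive_map t by move=> n x y; rewrite linearP.
exists (mk_char t_add) => a chi Ga; apply: char_inj => r.
rewrite char_scaleE -[RHS]/(t (a * r)); apply: tP.
exists (r *: chi); last by rewrite char_scaleE mulr1.
by rewrite /= mulrC; exact: (submemZ r Ga).
Qed.

End CharacterModule.

Lemma fct_baer (R : pzRingType) (I : Type) (J : lmodType R) :
  baer J -> baer (I -> J).
Proof.
move=> bJ G fG.
have Hj i : exists j : J, forall (a : R) x, G (a, x) -> x i = a *: j.
  pose H (u : R^o * J) := exists2 x, G (u.1, x) & u.2 = x i.
  have H0 : H 0 by exists 0 => //; exact: submem0.
  have HP a u v : H u -> H v -> H (a *: u + v).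
    move=> [x Gx uE] [y Gy vE]; exists (a *: x + y); last by rewrite /= uE vE.
    exact: (submemP2 a Gx Gy).
  have [|j jP] := bJ (Submodule (conj H0 HP)).
    by move=> x [y /= /fG -> ->].
  by exists j => a x Gax; apply: jP; exists x.
have [j jP] := choice Hj.
by exists j => a x Gax; apply/funext => i; exact: jP.
Qed.

(* The target is a product of copies of Hom_Z(R, Q/Z), one for each character *)
(* of M / S.                                                                  *)
Lemma enough_injectives (R : comPzRingType) (M : lmodType R) (S : submodule M) :
  exists (E : lmodType R) (lam : {linear M -> E}),
    extensible E /\ forall x, lam x = 0 <-> S x.
Proof.
have S0z : S (0 : zmodule M) by exact: submem0.
have SPz (n : int) (x y : zmodule M) : S x -> S y -> S (n *: x + y).
  move=> Sx Sy; have nx : n *: x = n%:~R *: (x : M) by rewrite scaler_int.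
  by rewrite nx; exact: submemP2.
pose Sz : submodule (zmodule M) := Submodule (conj S0z SPz).
pose I := {chi : {linear zmodule M -> QZ} | forall x, S x -> chi x = 0}.
have ch_add (chi : I) (m : M) : additive_map (fun r : R => sval chi (r *: m)).
  move=> n r s; rewrite -linearP; congr (sval chi _).
  rewrite scalerDl; congr (_ + _).
  by rewrite -[n *: (_ : zmodule M)]/((r *: m) *~ n) scalerMzl.
pose lam (m : M) : I -> character R := fun chi => mk_char (ch_add chi m).
have lam_lin : linear lam.
  move=> a x y; apply/funext => chi; apply: char_inj => r.
  rewrite -[LHS]/(sval chi (r *: (a *: x + y))) scalerDr scalerA mulrC.
  exact: (raddfD (sval chi)).
exists (I -> character R), (pack_linear lam_lin); split.
  exact/baer_extensible/fct_baer/character_baer.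
move=> m; split=> [lam0|Sm].
  apply: contrapT => /(@QZ_separates _ Sz)[chi chiS /eqP]; apply.
  have := congr1 (fun f => char_val (f (exist _ chi chiS)) 1) lam0.
  by rewrite -[LHS]/(chi (1 *: m)) scale1r.
apply/funext => -[chi chiS]; apply: char_inj => r.
by rewrite -[LHS]/(chi (r *: m)) chiS //; exact: submemZ.
Qed.

(** * Tensor products and Hom modules *)

Section TensorTheory.
Context (R : comPzRingType) (M N : lmodType R).

Lemma pure_bilinear : is_bilinear (@pure_tensor R M N).
Proof.
split=> [n a x y|m a x y]; apply: tensor_ext => P b hb;
  rewrite tensor_evalD // tensor_evalZ // !tensor_eval_class //
    /bilinear_sum !big_seq1 /=; first exact: hb.1.
exact: hb.2.
Qed.

Lemma tensor_sum (x : tensor M N) :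
  x = \sum_(p <- tensor_repr x) pure_tensor p.1 p.2.
Proof.
rewrite -[LHS]tensor_reprK; elim: (tensor_repr x) => [|p s IH].
  by rewrite big_nil.
rewrite big_cons -IH; apply: tensor_ext => P b hb.
by rewrite tensor_evalD // !tensor_eval_class // /bilinear_sum big_cons big_seq1.
Qed.

Lemma eq_tensor_fun (P : zmodType) (f g : {additive tensor M N -> P}) :
  (forall m n, f (pure_tensor m n) = g (pure_tensor m n)) -> f =1 g.
Proof.
move=> fg x; rewrite [x]tensor_sum !raddf_sum.
by apply: eq_bigr => p _; exact: fg.
Qed.

Lemma tensor_eval_linear (P : lmodType R) (b : M -> N -> P) :
  is_bilinear b -> linear (tensor_eval b).
Proof. by move=> hb a x y; rewrite tensor_evalD // tensor_evalZ. Qed.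

Lemma tensor_eval_pure (P : lmodType R) (b : M -> N -> P) m n :
  is_bilinear b -> tensor_eval b (pure_tensor m n) = b m n.
Proof. by move=> hb; rewrite tensor_eval_class // /bilinear_sum big_seq1. Qed.

Lemma bilinear_linear (P : lmodType R) (lam : {linear tensor M N -> P}) :
  is_bilinear (fun m n => lam (pure_tensor m n)).
Proof.
split=> [n a x y|m a x y]; first by rewrite (pure_bilinear.1 n) linearP.
by rewrite (pure_bilinear.2 m) linearP.
Qed.

Lemma tensor_eval_comp (P : lmodType R) (lam : {linear tensor M N -> P}) x :
  tensor_eval (fun m n => lam (pure_tensor m n)) x = lam x.
Proof.
pose hb := bilinear_linear lam.
apply: (@eq_tensor_fun P (pack_linear (tensor_eval_linear hb)) lam) => m n.
exact: tensor_eval_pure hb.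
Qed.

End TensorTheory.

Section HomModule.
Context (R : comPzRingType) (M N : lmodType R).

Fact linear_submodule : linear (0 : M -> N) /\
  forall a (f g : M -> N), linear f -> linear g -> linear (a *: f + g).
Proof.
split=> [a x y|a f g hf hg b x y]; first by rewrite scaler0 addr0.
rewrite !addrfctE !scalrfctE hf hg !scalerDr !scalerA (mulrC a b).
by rewrite addrACA.
Qed.

Definition homs : lmodType R := subcarrier (Submodule linear_submodule).

Definition hom_val (phi : homs) : M -> N := subval phi.

Lemma hom_linear phi : linear (hom_val phi).
Proof. by have /asboolP := valP phi. Qed.

HB.instance Definition _ (phi : homs) :=
  GRing.isLinear.Build R M N *:%R (hom_val phi) (hom_linear phi).

Lemma hom_inj (phi psi : homs) : hom_val phi =1 hom_val psi -> phi = psi.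
Proof. by move=> h; apply: val_inj; apply/funext. Qed.

Definition mk_hom (f : M -> N) (hf : linear f) : homs :=
  @Subcarrier _ _ (Submodule linear_submodule) f (introT (asboolP _) hf).

Lemma homP a (phi psi : homs) x :
  hom_val (a *: phi + psi) x = a *: hom_val phi x + hom_val psi x.
Proof. by []. Qed.

Lemma hom_val_linear x : linear (fun phi : homs => hom_val phi x).
Proof. by []. Qed.

Lemma hom_sum (I : Type) (s : seq I) (F : I -> homs) x :
  hom_val (\sum_(i <- s) F i) x = \sum_(i <- s) hom_val (F i) x.
Proof. exact: (raddf_sum (pack_linear (hom_val_linear x))). Qed.

End HomModule.

Lemma curry (R : comPzRingType) (F M E : lmodType R) (b : F -> M -> E) :
  is_bilinear b ->
  exists t : {linear F -> homs M E}, forall x m, hom_val (t x) m = b x m.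
Proof.
move=> [bl br]; pose t x := mk_hom (br x).
have t_lin : linear t by move=> a x y; apply: hom_inj => m; exact: bl.
by exists (pack_linear t_lin).
Qed.

Lemma uncurry_bilinear (R : comPzRingType) (F M E : lmodType R)
  (t : {linear F -> homs M E}) : is_bilinear (fun x m => hom_val (t x) m).
Proof. by split=> [m a x y|x a m n]; [rewrite linearP|exact: hom_linear]. Qed.

(** * Flat modules *)

(** An embedding of [F (x) M] into an injective [E] is a bilinear map; if it extends to [F x N], the
    embedding factors through [F (x) i], which is then injective. *)
Lemma flat_bilinear (R : comPzRingType) (F : lmodType R) :
  (forall (M N E : lmodType R) (i : {linear M -> N}) (b : F -> M -> E),
     injective i -> extensible E -> is_bilinear b ->
     exists2 b' : F -> N -> E, is_bilinear b' & forall x m, b' x (i m) = b x m) ->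
  flat F.
Proof.
move=> ext M N i i_inj x y ixy; apply/eqP; rewrite -subr_eq0; apply/eqP.
set z := x - y; have iz : tensor_map F i z = 0 by rewrite linearB /= ixy subrr.
have Z0 : (0 : tensor F M) = 0 by [].
have ZP a (u v : tensor F M) : u = 0 -> v = 0 -> a *: u + v = 0.
  by move=> -> ->; rewrite scaler0 addr0.
have [E [lam [eE lamP]]] := enough_injectives (Submodule (conj Z0 ZP)).
apply/lamP; have hb := bilinear_linear lam.
have [b' hb' b'P] := ext _ _ _ _ _ i_inj eE hb.
rewrite -tensor_eval_comp.
have <- : (fun x m => b' x (i m)) = (fun x m => lam (pure_tensor x m)).
  by apply/funext => u; apply/funext => m.
by rewrite -tensor_eval_map // iz tensor_eval0.
Qed.

(** For injective [E], restriction [Hom(N, E) -> Hom(M, E)] is surjective, and maps from [P] lift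
    along it. *)
Lemma projective_flat (R : comPzRingType) (P : lmodType R) :
  projective P -> flat P.
Proof.
move=> pP; apply: flat_bilinear => M N E i b i_inj eE hb.
have [t tP] := curry hb.
pose r (phi : homs N E) : homs M E := mk_hom (linearP (hom_val phi \o i)).
have r_lin : linear r by move=> a phi psi; apply: hom_inj.
have [|t' t'P] := pP _ _ (pack_linear r_lin) t.
  move=> phi; have [g gP] := extensible_injective eE (hom_val phi) i_inj.
  by exists (mk_hom (linearP g)); apply: hom_inj.
exists (fun x n => hom_val (t' x) n) => [|x m]; first exact: uncurry_bilinear.
by rewrite -tP -t'P.
Qed.

(** The equational criterion of flatness: every relation in [F] comes from relations in [R]. Each
    instance involves finitely many elements, so that denominators can be cleared. *)
Definition equationally_flat (R : comPzRingType) (F : lmodType R) : Prop :=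
  forall (n : nat) (a : 'I_n -> R) (x : 'I_n -> F), \sum_i a i *: x i = 0 ->
  exists (K : finType) (b : 'I_n -> K -> R) (y : K -> F),
    (forall i, x i = \sum_k b i k *: y k) /\
    (forall k, \sum_i a i * b i k = 0).

Lemma pair_sum (M N : nmodType) (I : Type) (s : seq I) (f : I -> M * N) :
  \sum_(i <- s) f i = (\sum_(i <- s) (f i).1, \sum_(i <- s) (f i).2).
Proof.
elim: s => [|i s IH]; first by rewrite !big_nil.
by rewrite !big_cons IH; case: (f i).
Qed.

Lemma equationally_flat_baer (R : comPzRingType) (F E : lmodType R) :
  equationally_flat F -> extensible E -> baer (homs F E).
Proof.
move=> eF eE H fH.
(* With [I] the ideal on which [H] is defined, this is the map [I F -> E] sending [a x] to
   [H(a)(x)]. It is well defined because relations in [F] are trivial. *)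
pose G (u : F * E) := exists s : seq (R * homs F E * F),
  (forall p, p \in s -> H (p.1.1, p.1.2)) /\
  u = (\sum_(p <- s) p.1.1 *: p.2, \sum_(p <- s) hom_val p.1.2 p.2).
have G0 : G 0 by exists [::]; rewrite !big_nil.
have GP a u v : G u -> G v -> G (a *: u + v).
  move=> [s [Hs ->]] [t [Ht ->]].
  exists ([seq (p.1, a *: p.2) | p <- s] ++ t); split.
    by move=> p; rewrite mem_cat => /orP[/mapP[q /Hs Hq ->]|/Ht].
  rewrite !big_cat !big_map; congr (_ + _, _ + _) => /=; rewrite scaler_sumr;
    apply: eq_bigr => p _; first by rewrite !scalerA mulrC.
  by rewrite linearZ.
have fG : functional (Submodule (conj G0 GP)).
  move=> e [s [Hs [/esym]]]; rewrite big_tnth => s0 ->.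
  have [K [b [y [xE ab]]]] := eF _ _ _ s0.
  rewrite big_tnth (eq_bigr (fun i => \sum_k b i k *:
    hom_val (tnth (in_tuple s) i).1.2 (y k))); last first.
    by move=> i _; rewrite xE linear_sum; apply: eq_bigr => k _; rewrite linearZ.
  rewrite exchange_big big1 // => k _.
  (* [psi] is the value of the partial map [H] at [\sum_i a i * b i k = 0]. *)
  pose psi := \sum_i b i k *: (tnth (in_tuple s) i).1.2.
  suff psi0 : psi = 0.
    rewrite -[RHS](_ : hom_val psi (y k) = 0); last by rewrite psi0.
    by rewrite hom_sum; apply: eq_bigr.
  apply: fH; rewrite -(ab k).
  have -> : (\sum_i (tnth (in_tuple s) i).1.1 * b i k, psi) =
     \sum_i b i k *: (((tnth (in_tuple s) i).1.1 : R^o), (tnth (in_tuple s) i).1.2).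
    rewrite pair_sum; congr (_, _); apply: eq_bigr => i _; exact: mulrC.
  apply: submem_sum => i; apply/submemZ/Hs; exact: mem_tnth.
have [t tP] := eE _ _ fG.
exists (mk_hom (linearP t)) => a chi Ha; apply: hom_inj => x.
change (hom_val chi x = a *: t x); rewrite -linearZ; apply: tP.
exists [:: (a, chi, x)]; rewrite !big_seq1; split=> // p.
by rewrite inE => /eqP ->.
Qed.

(** A bilinear map on [F x M] is a linear map from [M] to [Hom(F, E)], which is injective by
    [equationally_flat_baer]. *)
Lemma equationally_flat_flat (R : comPzRingType) (F : lmodType R) :
  equationally_flat F -> flat F.
Proof.
move=> eF; apply: flat_bilinear => M N E i b i_inj eE hb.
have hb' : is_bilinear (fun m x => b x m) by case: hb.
have [t tP] := curry hb'.
have inj_hom := extensible_injective (baer_extensible (equationally_flat_baer eF eE)).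
have [t' t'P] := inj_hom _ _ i t i_inj.
exists (fun x n => hom_val (t' n) x) => [|x m]; last by rewrite t'P tP.
by have [] := uncurry_bilinear t'.
Qed.

(** * Coherent rings *)

Lemma linear_row_eq (R : comPzRingType) (n : nat) (M : lmodType R)
    (f g : {linear 'rV[R]_n -> M}) :
  (forall i, f (delta_mx 0 i) = g (delta_mx 0 i)) -> f =1 g.
Proof.
move=> fg v; rewrite [v]row_sum_delta !linear_sum; apply: eq_bigr => i _.
by rewrite !linearZ fg.
Qed.

Lemma lift_row (R : comPzRingType) (m n : nat) (M : lmodType R)
    (f : {linear 'rV[R]_m -> M}) (g : {linear 'rV[R]_n -> M}) :
  surjective g -> exists A : 'M[R]_(m, n), forall v, g (v *m A) = f v.
Proof.
move=> g_surj; have [h hP] := choice (fun i => g_surj (f (delta_mx 0 i))).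
exists (\matrix_i h i).
apply: (@linear_row_eq _ _ _ (g \o mulmxr (\matrix_i h i)) f) => i /=.
by rewrite -rowE rowK.
Qed.

(* Schanuel: as the ideal (a_i) has some finite presentation, the module of   *)
(* relations between the given generators a_i is finitely generated too.      *)
Lemma coherent_syzygies (R : comPzRingType) (n : nat) (a : 'I_n -> R) :
  coherent R ->
  exists (m : nat) (b : 'M[R]_(m, n)), forall r : 'rV[R]_n,
    \sum_i a i * r 0 i = 0 <-> exists c : 'rV[R]_m, r = c *m b.
Proof.
move=> cR.
pose g0 (r : 'rV[R]_n) : R^o := \sum_i a i * r 0 i.
have g0_lin : linear g0.
  move=> x u v; rewrite /g0 scaler_sumr -big_split; apply: eq_bigr => i _.
  by rewrite !mxE mulrDr mulrCA.
have I0 : exists r, (0 : R^o) = g0 r.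
  by exists 0; exact: esym (linear0 (pack_linear g0_lin)).
have IP x (u v : R^o) : (exists r, u = g0 r) -> (exists r, v = g0 r) ->
    exists r, x *: u + v = g0 r.
  by move=> [r ->] [s ->]; exists (x *: r + s); rewrite g0_lin.
pose I := Submodule (conj I0 IP).
have g1P r : g0 r \in submemb I by apply/asboolP; exists r.
pose g1 r : subcarrier I := Subcarrier (g1P r).
have g1_lin : linear g1 by move=> x u v; apply: val_inj; exact: g0_lin.
have g1_surj : surjective (pack_linear g1_lin).
  move=> y; have /asboolP[r yr] := valP y; exists r.
  by apply: val_inj; exact: esym yr.
have [||m [n' [f [g [g_surj fg]]]]] := cR (subcarrier I) \val.
- exact: val_inj.
- by exists n, (pack_linear g1_lin).
have [A AP] := lift_row g g1_surj.
have [B BP] := lift_row (pack_linear g1_lin) g_surj.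
have [F FP] := lift_row f (fun y => ex_intro (fun x => idfun x = y) y erefl).
have g1_eq0 r : pack_linear g1_lin r = 0 <-> \sum_i a i * r 0 i = 0.
  by split=> [/(congr1 val)|r0]; [|apply: val_inj].
(* The relations of the given presentation, translated by [A], and the differences between the
   generators and their images under [B] then [A]: a relation is [r = (r B) A + r (1 - B A)], with
   [r B] in the image of [f]. *)
exists (m + n)%N, (col_mx (F *m A) (1%:M - B *m A)) => r; split=> [/g1_eq0 r0|].
  have [w wP] : exists w, f w = r *m B by apply/fg; rewrite BP.
  exists (row_mx w r); rewrite mul_row_col mulmxBr mulmx1 !mulmxA -wP.
  by rewrite -(FP w) addrC subrK.
move=> [c ->]; apply/g1_eq0; rewrite -(hsubmxK c) mul_row_col mulmxBr mulmx1.
rewrite !mulmxA linearD linearB !AP BP subrr addr0 [_ *m F](FP _).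
by apply/fg; exists (lsubmx c).
Qed.

(** With [b] spanning the syzygies of [a], the sequence [R^m -> R^n -> R] is exact, hence so is
    [J -> J^n -> J^m] for injective [J]. The sum of the [phi i] vanishes on the image of [J], so it
    factors through the image of [bJ] and extends to [J^m] by injectivity of [E]. The components of
    the extension [psi] solve the relation. *)
Lemma coherent_homs_flat (R : comPzRingType) (J E : lmodType R) :
  coherent R -> extensible J -> extensible E -> equationally_flat (homs J E).
Proof.
move=> cR eJ eE n a phi phi0.
have [m [b bP]] := coherent_syzygies a cR.
pose bJ (j : 'I_n -> J) : 'I_m -> J := fun k => \sum_i b k i *: j i.
pose pE (j : 'I_n -> J) : E := \sum_i hom_val (phi i) (j i).
have bJ_lin : linear bJ.
  move=> x u v; apply/funext => k; rewrite /bJ !addrfctE !scalrfctE.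
  rewrite scaler_sumr -big_split; apply: eq_bigr => i _ /=.
  by rewrite scalerDr !scalerA mulrC.
have pE_lin : linear pE.
  move=> x u v; rewrite /pE scaler_sumr -big_split; apply: eq_bigr => i _ /=.
  by rewrite linearP.
have bJ_ker j : bJ j = 0 -> exists j0, forall i, j i = a i *: j0.
  move=> bj0.
  (* As [j] is killed by the syzygies, [\sum a_i r_i |-> \sum r_i j_i] is well defined on the ideal
     of the [a_i]; [j0] is the value at 1 of its extension to [R]. *)
  pose H (u : R^o * J) := exists r : 'rV[R]_n,
    u = (\sum_i a i * r 0 i, \sum_i r 0 i *: j i).
  have H0 : H 0.
    exists 0; congr (_, _); rewrite big1 // => i _; rewrite mxE ?mulr0 //.
    by rewrite scale0r.
  have HP x u v : H u -> H v -> H (x *: u + v).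
    move=> [r ->] [s ->]; exists (x *: r + s); congr (_, _) => /=.
      rewrite [x *: _]mulr_sumr -big_split; apply: eq_bigr => i _ /=.
      by rewrite !mxE mulrDr mulrCA.
    rewrite scaler_sumr -big_split; apply: eq_bigr => i _ /=.
    by rewrite !mxE scalerDl scalerA.
  have [|t tP] := eJ _ (Submodule (conj H0 HP)).
    move=> x [r [/esym/bP[c ->] ->]].
    under eq_bigr => i _ do rewrite mxE scaler_suml.
    rewrite exchange_big big1 // => k _.
    under eq_bigr => i _ do rewrite -scalerA.
    by rewrite -scaler_sumr -[\sum_(i < n) _]/(bJ j k) bj0 scaler0.
  exists (t 1) => i; rewrite -linearZ; apply: tP.
  exists (delta_mx 0 i); congr (_, _).
    rewrite (bigD1 i) //= mxE !eqxx mulr1 big1 ?addr0 ?[_ *: _]mulr1 // => k ki.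
    by rewrite mxE (negPf ki) andbF mulr0.
  rewrite (bigD1 i) //= mxE !eqxx scale1r big1 ?addr0 // => k ki.
  by rewrite mxE (negPf ki) andbF scale0r.
pose G (u : ('I_m -> J) * E) := exists j, u = (bJ j, pE j).
have G0 : G 0.
  exists 0; have bJ0 : bJ 0 = 0 := linear0 (pack_linear bJ_lin).
  by have pE0 : pE 0 = 0 := linear0 (pack_linear pE_lin); rewrite bJ0 pE0.
have GP x u v : G u -> G v -> G (x *: u + v).
  by move=> [i ->] [j ->]; exists (x *: i + j); rewrite bJ_lin pE_lin.
have [|psi psiP] := eE _ (Submodule (conj G0 GP)).
  move=> e [j [/esym/bJ_ker[j0 jE] ->]].
  have <- : hom_val (\sum_i a i *: phi i) j0 = 0 by rewrite phi0.
  by rewrite hom_sum; apply: eq_bigr => i _; rewrite jE linearZ.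
pose single n k (j : J) : 'I_n -> J := fun l => if l == k then j else 0.
have single_lin l k : linear (@single l k).
  move=> x u v; apply/funext => i; rewrite !addrfctE !scalrfctE /single.
  by case: eqP => // _; rewrite scaler0 addr0.
have psi_lin k : linear (psi \o @single m k).
  by move=> x u v /=; rewrite single_lin linearP.
exists 'I_m, (fun i k => b k i), (fun k => mk_hom (psi_lin k)); split=> [i|k].
  apply: hom_inj => j; rewrite hom_sum.
  have -> : hom_val (phi i) j = psi (bJ (single n i j)).
    rewrite -(psiP _ (pE (single n i j))); last by exists (single n i j).
    rewrite /pE (bigD1 i) //= /single eqxx big1 ?addr0 // => k /negPf ->.
    by rewrite linear0.
  have -> : bJ (single n i j) = \sum_k b k i *: single m k j.
    apply/funext => k; rewrite fct_sumE /bJ (bigD1 i) //= (bigD1 k) //=.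
    rewrite !big1 ?addr0 => [|l lk|l li].
    - by rewrite scalrfctE /single !eqxx.
    - by rewrite scalrfctE /single eq_sym (negPf lk) scaler0.
    - by rewrite /single (negPf li) scaler0.
  by rewrite linear_sum; apply: eq_bigr => k _; rewrite linearZ.
have /bP : exists c, row k b = c *m b by exists (delta_mx 0 k); rewrite rowE.
by under eq_bigr => i _ do rewrite mxE.
Qed.

(** * Localization *)

Section Restriction.
Context (R S : comPzRingType) (rho : {rmorphism R -> S}).

Definition restriction (rho : {rmorphism R -> S}) (M : lmodType S) : Type := M.

Context (M : lmodType S).
Local Notation MR := (restriction rho M).

HB.instance Definition _ := GRing.Zmodule.on MR.

Definition restriction_scale (a : R) (x : MR) : MR := rho a *: (x : M).

Fact restriction_scaleA a b x :
  restriction_scale a (restriction_scale b x) = restriction_scale (a * b) x.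
Proof. by rewrite /restriction_scale scalerA rmorphM. Qed.

Fact restriction_scale1 : left_id 1 restriction_scale.
Proof. by move=> x; rewrite /restriction_scale rmorph1 scale1r. Qed.

Fact restriction_scaleDr : right_distributive restriction_scale +%R.
Proof. by move=> a x y; exact: scalerDr. Qed.

Fact restriction_scaleDl x : {morph restriction_scale^~ x : a b / a + b}.
Proof. by move=> a b; rewrite /restriction_scale rmorphD; exact: scalerDl. Qed.

HB.instance Definition _ := GRing.Zmodule_isLmodule.Build R MR
  restriction_scaleA restriction_scale1 restriction_scaleDr restriction_scaleDl.

Lemma restriction_scaleE a (x : MR) : a *: x = rho a *: (x : M).
Proof. by []. Qed.

End Restriction.

Lemma semilinearZ (R S : comPzRingType) (rho : {rmorphism R -> S})
    (M : lmodType R) (N : lmodType S) (r : {linear M -> N | rho \; *:%R}) a x :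
  r (a *: x) = rho a *: r x.
Proof. exact: linearZ. Qed.

Lemma common_exponent (I : finType) (P : I -> nat -> Prop) :
  (forall i k l, (k <= l)%N -> P i k -> P i l) -> (forall i, exists k, P i k) ->
  exists k, forall i, P i k.
Proof.
move=> Pmono /choice[k kP]; exists (\max_i k i)%N => i.
by apply: Pmono (kP i); exact: leq_bigmax.
Qed.

Section Localization.
Context (A S : comPzRingType) (f : A) (rho : {rmorphism A -> S}).
Hypothesis loc : is_localization f rho.

Lemma localization_common_denominator (I : finType) (s : I -> S) :
  exists (k : nat) (a : I -> A), forall i, rho f ^+ k * s i = rho (a i).
Proof.
case: loc => _ frac _.
have [|k kP] := @common_exponent I
  (fun i k => exists a, rho f ^+ k * s i = rho a) _ (fun i => frac (s i)).
  move=> i k l kl [a aP]; exists (f ^+ (l - k) * a).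
  by rewrite -(subnK kl) exprD -mulrA aP rmorphM rmorphXn addnK.
by have [a aP] := choice kP; exists k, a.
Qed.

Lemma localization_expI (M : lmodType S) k (x y : M) :
  rho f ^+ k *: x = rho f ^+ k *: y -> x = y.
Proof.
case: loc => -[c fc] _ _ /(congr1 ( *:%R (c ^+ k))).
by rewrite !scalerA -exprMn mulrC fc expr1n !scale1r.
Qed.

Lemma localization_divr (M : lmodType S) k (x : M) :
  exists y, x = rho f ^+ k *: y.
Proof.
case: loc => -[c fc] _ _; exists (c ^+ k *: x).
by rewrite scalerA -exprMn fc expr1n scale1r.
Qed.

Section ModuleLocalization.
Context (M : lmodType A) (N : lmodType S) (r : {linear M -> N | rho \; *:%R}).
Hypothesis locM : is_module_localization f r.

Lemma module_localization_common_denominator (I : finType) (y : I -> N) :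
  exists (k : nat) (x : I -> M), forall i, rho f ^+ k *: y i = r (x i).
Proof.
case: locM => _ frac _.
have [|k kP] := @common_exponent I
  (fun i k => exists x, rho f ^+ k *: y i = r x) _ (fun i => frac (y i)).
  move=> i k l kl [x xP]; exists (f ^+ (l - k) *: x).
  by rewrite -(subnK kl) exprD -scalerA xP linearZ /= rmorphXn addnK.
by have [x xP] := choice kP; exists k, x.
Qed.

(** The universal property: if [f^k n = r m], the image of [n] must be the [t] with [f^k t = u m],
    and [wd] shows that [k] and [m] do not affect it. *)
Lemma module_localization_lift (T : lmodType S)
    (u : {linear M -> T | rho \; *:%R}) :
  exists u' : {linear N -> T}, forall x, u' (r x) = u x.
Proof.
case: locM => _ frac tor.
have wd n k m k' m' : rho f ^+ k *: n = r m -> rho f ^+ k' *: n = r m' ->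
    rho f ^+ k *: u m' = rho f ^+ k' *: u m.
  move=> nm nm'.
  have [|l lP] := tor (f ^+ k *: m' - f ^+ k' *: m).
    by rewrite linearB !semilinearZ -nm -nm' !rmorphXn !scalerA mulrC subrr.
  apply: (@localization_expI _ l); apply/eqP; rewrite -subr_eq0 -scalerBr.
  apply/eqP; have := congr1 u lP.
  by rewrite raddf0 semilinearZ linearB !semilinearZ !rmorphXn.
have exu n : exists t, forall k m, rho f ^+ k *: n = r m -> rho f ^+ k *: t = u m.
  have [k [m nm]] := frac n; have [t tP] := localization_divr k (u m).
  exists t => k' m' nm'; apply: (@localization_expI _ k).
  by rewrite (wd n k m k' m') // tP !scalerA mulrC.
have [u' u'P] := choice exu.
have u'_lin : linear u'.
  move=> s x y.
  have [j [a ja]] := localization_common_denominator (fun _ : 'I_1 => s).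
  have [k [m km]] := frac x; have [l [p lp]] := frac y.
  apply: (@localization_expI _ (j + k + l)).
  have expand (L : lmodType S) (v w : L) : rho f ^+ (j + k + l) *: (s *: v + w) =
      rho f ^+ l *: (rho (a ord0) *: (rho f ^+ k *: v)) + rho f ^+ (j + k) *: (rho f ^+ l *: w).
    rewrite -ja scalerDr !scalerA -exprD; congr (_ *: _ + _).
    by rewrite !exprD; ring.
  rewrite (u'P _ _ (f ^+ l *: (a ord0 *: m) + f ^+ (j + k) *: p)).
    by rewrite expand (u'P _ _ _ km) (u'P _ _ _ lp) linearD !semilinearZ !rmorphXn.
  by rewrite expand km lp linearD !semilinearZ !rmorphXn.
exists (pack_linear u'_lin) => x.
by have := u'P (r x) 0%N x; rewrite !expr0 !scale1r; apply.
Qed.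

End ModuleLocalization.

(** * Localized modules as base changes *)

Section Existence.
Context (M : lmodType A).

Let SA : lmodType A := restriction rho S^o.
(** A separate name for the tensor product, so that it can carry the [S]-module structure coming
    from its second factor. *)
Definition base_change : Type := tensor M SA.

HB.instance Definition _ := GRing.Zmodule.on base_change.

Fact mul_linear (s : S) : linear ( *%R s : SA -> SA).
Proof.
move=> a x y; rewrite mulrDr; congr (_ + _).
by rewrite !restriction_scaleE; exact: mulrCA.
Qed.

Definition base_change_scale (s : S) (x : base_change) : base_change :=
  tensor_map M (pack_linear (mul_linear s)) x.

Lemma base_change_scale_pure s m t :
  base_change_scale s (@pure_tensor A M SA m t) = @pure_tensor A M SA m (s * t).
Proof. exact: tensor_map_pure. Qed.

Fact base_change_scaleDr : right_distributive base_change_scale +%R.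
Proof. by move=> s x y; exact: raddfD. Qed.

Fact base_change_scaleA s t x :
  base_change_scale s (base_change_scale t x) = base_change_scale (s * t) x.
Proof.
move: x; apply: (@eq_tensor_fun A M SA _
  (tensor_map M (pack_linear (mul_linear s)) \o tensor_map M (pack_linear (mul_linear t)))
  (tensor_map M (pack_linear (mul_linear (s * t))))) => m n.
change (base_change_scale s (base_change_scale t (@pure_tensor A M SA m n)) =
  base_change_scale (s * t) (@pure_tensor A M SA m n)).
by rewrite !base_change_scale_pure mulrA.
Qed.

Fact base_change_scale1 : left_id 1 base_change_scale.
Proof.
move=> x; apply: (@eq_tensor_fun A M SA _
  (tensor_map M (pack_linear (mul_linear 1))) idfun) => m n.
change (base_change_scale 1 (@pure_tensor A M SA m n) = @pure_tensor A M SA m n).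
by rewrite base_change_scale_pure mul1r.
Qed.

Fact base_change_scaleDl x : {morph base_change_scale^~ x : s t / s + t}.
Proof.
move=> s t; move: x; apply: (@eq_tensor_fun A M SA _
  (tensor_map M (pack_linear (mul_linear (s + t))))
  (tensor_map M (pack_linear (mul_linear s)) \+ tensor_map M (pack_linear (mul_linear t)))) => m n.
change (base_change_scale (s + t) (@pure_tensor A M SA m n) =
  base_change_scale s (@pure_tensor A M SA m n) +
  base_change_scale t (@pure_tensor A M SA m n)).
rewrite !base_change_scale_pure mulrDl.
exact: (raddfD (pack_linear ((pure_bilinear M SA).2 m))).
Qed.

HB.instance Definition _ := GRing.Zmodule_isLmodule.Build S base_change
  base_change_scaleA base_change_scale1 base_change_scaleDr base_change_scaleDl.


Definition base_change_of (m : M) : base_change := @pure_tensor A M SA m 1.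

Fact base_change_of_linear : linear_for (rho \; *:%R) base_change_of.
Proof.
move=> a x y; rewrite /base_change_of; have [pl pr] := pure_bilinear M SA.
rewrite pl; congr (_ + _).
rewrite -[RHS]/(base_change_scale (rho a) (@pure_tensor A M SA x 1)).
rewrite base_change_scale_pure -[_ *: _]addr0.
have p0 : @pure_tensor A M SA x 0 = 0 := bilinear0r x (pure_bilinear M SA).
by rewrite -p0 -pr addr0.
Qed.

Let seqfrac (k : nat) (a : A) (m : M) : nat -> M := fun i => (f ^+ (i - k) * a) *: m.

Let eventually_zero (u : nat -> M) := exists n, forall i, (n <= i)%N -> u i = 0.

Fact eventually_zero_submodule : eventually_zero 0 /\
  forall a u v, eventually_zero u -> eventually_zero v ->
    eventually_zero (a *: u + v).
Proof.
split=> [|a u v [n un] [p vp]]; first by exists 0%N.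
exists (n + p)%N => i npi; rewrite addrfctE scalrfctE un ?vp ?scaler0 ?addr0 //.
  exact: leq_trans (leq_addl _ _) npi.
exact: leq_trans (leq_addr _ _) npi.
Qed.

Let frac_uniq k a k' a' m s : rho f ^+ k * s = rho a -> rho f ^+ k' * s = rho a' ->
  eventually_zero (seqfrac k a m - seqfrac k' a' m).
Proof.
case: loc => _ _ tor sa sa'.
have [|l lP] := tor (f ^+ k' * a - f ^+ k * a').
  by rewrite rmorphB !rmorphM !rmorphXn -sa -sa'; ring.
exists (k + k' + l)%N => i ige; rewrite /seqfrac addrfctE opprfctE -scalerBl.
have -> : (i - k = (i - (k + k' + l)) + (l + k'))%N by lia.
have -> : (i - k' = (i - (k + k' + l)) + (l + k))%N by lia.
rewrite (_ : _ - _ = f ^+ (i - (k + k' + l)) * (f ^+ l * (f ^+ k' * a - f ^+ k * a'))).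
  by rewrite lP mulr0 scale0r.
by rewrite !exprD; ring.
Qed.

(* The localization of M is a module of fractions: (m, a / f^k) is sent to    *)
(* the class, modulo finite modifications, of the sequence f^(i - k) a m.     *)
Fact base_change_of_eq0 m : base_change_of m = 0 -> exists k, f ^+ k *: m = 0.
Proof.
move=> m0.
(* [lam] kills exactly the eventually zero sequences, and so stands for the quotient map by them. *)
have [E [lam [_ lamP]]] := enough_injectives (Submodule eventually_zero_submodule).
have [k kP] := choice (fun s => let: And3 _ h _ := loc in h s).
have [a aP] := choice kP.
pose b (x : M) (s : SA) : E := lam (seqfrac (k s) (a s) x).
have bE x s j c : rho f ^+ j * s = rho c -> b x s = lam (seqfrac j c x).
  move=> sc; apply/eqP; rewrite -subr_eq0 -linearB; apply/eqP/lamP.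
  exact: frac_uniq (aP s) sc.
have b_bil : is_bilinear b.
  split=> [s c x y|x c s t].
    rewrite /b -linearP; congr (lam _); apply/funext => i.
    by rewrite addrfctE scalrfctE /seqfrac scalerDr !scalerA mulrC.
  rewrite (bE x s (k s + k t)%N (f ^+ k t * a s)); last first.
    by rewrite rmorphM rmorphXn -aP exprD; ring.
  rewrite (bE x t (k s + k t)%N (f ^+ k s * a t)); last first.
    by rewrite rmorphM rmorphXn -aP exprD; ring.
  rewrite (bE x _ (k s + k t)%N (c * (f ^+ k t * a s) + f ^+ k s * a t)); last first.
    rewrite restriction_scaleE rmorphD !rmorphM !rmorphXn -!aP exprD mulrDr.
    by rewrite -[_ *: _]/(rho c * s); ring.
  rewrite -linearP; congr (lam _); apply/funext => i.
  by rewrite addrfctE scalrfctE /seqfrac scalerA -scalerDl mulrDr mulrCA.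
have := tensor_eval_pure m (1 : SA) b_bil.
have b0 : tensor_eval b 0 = 0 := linear0 (pack_linear (tensor_eval_linear b_bil)).
rewrite -/(base_change_of m) m0 b0.
(* Writing 1 as 1 / f^0 gives the sequence [f^i m], which must vanish at some index [n]. *)
rewrite (bE m _ 0%N 1) ?expr0 ?mul1r ?rmorph1 // => /esym/lamP[n /(_ n (leqnn n))].
by rewrite /seqfrac subn0 mulr1; exists n.
Qed.

Lemma base_change_localization :
  is_module_localization f (pack_linear base_change_of_linear).
Proof.
case: loc => inv frac tor; split=> //; last exact: base_change_of_eq0.
move=> y.
have [k [a aP]] := localization_common_denominator
  (fun i : 'I_(size (tensor_repr y)) => (tnth (in_tuple (tensor_repr y)) i).2).
exists k, (\sum_i a i *: (tnth (in_tuple (tensor_repr y)) i).1).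
rewrite linear_sum [in LHS](tensor_sum y) big_tnth.
rewrite (raddf_sum ( *:%R (rho f ^+ k) : base_change -> base_change)).
apply: eq_bigr => i _; rewrite semilinearZ -aP.
set p := tnth _ i.
change (base_change_scale (rho f ^+ k) (@pure_tensor A M SA p.1 p.2) =
  base_change_scale (rho f ^+ k * p.2) (@pure_tensor A M SA p.1 1)).
by rewrite !base_change_scale_pure mulr1.
Qed.

End Existence.

Lemma module_localization_exists (M : lmodType A) :
  exists (N : lmodType S) (r : {linear M -> N | rho \; *:%R}),
    is_module_localization f r.
Proof. by do 2 eexists; exact: base_change_localization. Qed.

(** With denominators cleared and a further factor [f^j], the relation holds in [M]; the vectors
    that solve it there are mapped to [N] and divided by [f^l]. *)
Lemma equationally_flat_localization (M : lmodType A) (N : lmodType S)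
    (r : {linear M -> N | rho \; *:%R}) :
  is_module_localization f r -> equationally_flat M -> equationally_flat N.
Proof.
move=> locM eM n s y sy0; have [_ _ tor] := locM.
have [k [a aP]] := localization_common_denominator s.
have [l [x xP]] := module_localization_common_denominator locM y.
have [|j jP] := tor (\sum_i a i *: x i).
  rewrite linear_sum; transitivity (rho f ^+ (k + l) *: (\sum_i s i *: y i)).
    rewrite scaler_sumr; apply: eq_bigr => i _.
    by rewrite semilinearZ -aP -xP !scalerA exprD; congr (_ *: _); ring.
  by rewrite sy0 scaler0.
have [|K [b [z [xE ab]]]] := eM n (fun i => f ^+ j * a i) x.
  by rewrite -[RHS]jP scaler_sumr; apply: eq_bigr => i _; rewrite scalerA.
have [t tP] := choice (fun k => localization_divr l (r (z k))).
exists K, (fun i k => rho (b i k)), t; split=> [i|p].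
  apply: (@localization_expI _ l); rewrite xP xE linear_sum scaler_sumr.
  by apply: eq_bigr => p _; rewrite semilinearZ tP !scalerA mulrC.
apply: (@localization_expI S^o (j + k)); rewrite scaler0.
transitivity (rho (\sum_i f ^+ j * a i * b i p)); last by rewrite ab rmorph0.
rewrite rmorph_sum -[LHS]/(_ * _) mulr_sumr; apply: eq_bigr => i _.
by rewrite !rmorphM rmorphXn -aP exprD; ring.
Qed.

(** The relation is solved over [S]; [f^k] clears the coefficients, [f^l] makes their relations hold
    in [A], and dividing the vectors [y] by [f^(l+k)] compensates. *)
Lemma equationally_flat_restriction (M : lmodType S) :
  equationally_flat M -> equationally_flat (restriction rho M).
Proof.
move=> eM n a x ax0; have [_ _ tor] := loc.
have [K [b [y [xE ab]]]] := eM n (rho \o a) x ax0.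
have [k [c cP]] := localization_common_denominator (fun p : 'I_n * K => b p.1 p.2).
have [||l lP] := @common_exponent K
  (fun p l => f ^+ l * (\sum_i a i * c (i, p)) = 0).
- move=> p l l' ll'; rewrite -(subnK ll') exprD -mulrA => ->.
  by rewrite mulr0.
- move=> p; apply: tor; rewrite rmorph_sum.
  transitivity (rho f ^+ k * \sum_i (rho \o a) i * b i p); last by rewrite ab mulr0.
  rewrite mulr_sumr; apply: eq_bigr => i _.
  by rewrite rmorphM -cP; ring.
have [z zP] := choice (fun p => localization_divr (l + k) (y p)).
exists K, (fun i p => f ^+ l * c (i, p)), z; split=> [i|p].
  rewrite xE; apply: eq_bigr => p _; rewrite restriction_scaleE rmorphM -cP.
  transitivity ((b i p * rho f ^+ (l + k)) *: (z p : M)).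
    by rewrite zP scalerA.
  apply: (congr1 (fun s : S => s *: (z p : M))).
  by rewrite rmorphXn exprD /=; ring.
transitivity (f ^+ l * \sum_i a i * c (i, p)); last exact: lP.
by rewrite mulr_sumr; apply: eq_bigr => i _; exact: mulrCA.
Qed.

End Localization.

(** * Totally acyclic complexes *)

Lemma Hom_acyclic_intro (R : comPzRingType) (C : complex R) (Q : lmodType R) :
  (forall n (g : {linear C (n - 1) -> Q}), (forall x, g (cdiff C n x) = 0) ->
     exists h : {linear C (n - 1 - 1) -> Q}, forall y, h (cdiff C (n - 1) y) = g y) ->
  Hom_acyclic C Q.
Proof.
move=> ext n g; split=> [/ext //|[h hg] x].
by rewrite -hg cdiff_cdiff linear0.
Qed.

(** As the terms of [C] are projective, [Hom(C, -)] keeps [0 -> K -> Q -> F -> 0] exact; this is the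
    resulting long exact sequence, chased by hand. *)
Lemma Hom_acyclic_cokernel (R : comPzRingType) (C : complex R)
    (K Q F : lmodType R) (i : {linear K -> Q}) (e : {linear Q -> F}) :
  (forall n, projective (C n)) -> injective i -> surjective e -> exact_at i e ->
  Hom_acyclic C K -> Hom_acyclic C Q -> Hom_acyclic C F.
Proof.
move=> pC i_inj e_surj ie CK CQ; apply: Hom_acyclic_intro => n.
(* The map [k] below lives in degree [n]; writing [n] as [m - 1] is the form in which [Hom_acyclic]
   applies to it. *)
have [m -> g gd] : exists m, n = m - 1 by exists (n + 1); rewrite addrK.
have [g' g'P] := pC (m - 1 - 1) _ _ e g e_surj.
have im_i x : exists k, i k = g' (cdiff C (m - 1) x) by apply/ie; rewrite g'P.
have [k kP] := choice im_i.
have k_lin : linear k.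
  by move=> a x y; apply: i_inj; rewrite kP !linearP !kP.
have [|h hP] := (CK m (pack_linear k_lin)).1.
  by move=> x; apply: i_inj; rewrite kP cdiff_cdiff !linear0.
have [|q qP] := (CQ (m - 1) (g' \- (i \o h))).1.
  by move=> x; rewrite /= hP kP subrr.
exists (e \o q) => y /=; rewrite qP /= linearB g'P.
suff -> : e (i (h y)) = 0 by rewrite subr0.
by apply/ie; exists (h y).
Qed.

Lemma proj_dim_Hom_acyclic (R : comPzRingType) (C : complex R) (d : nat)
    (F : lmodType R) :
  totally_acyclic C -> proj_dim_le d F -> Hom_acyclic C F.
Proof.
move=> [pC _ CQ] [P [delta [eps [pP P0 eps_surj exact0 exactS]]]].
(* From here [d] bounds the number of nonzero terms: [P n = 0] for [n >= d]. For [d = 0] even [P 0]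
   vanishes, and with it [F]; otherwise the kernel of [eps] has a resolution shorter by one. *)
move: d.+1 P0 => {}d; elim: d => [|d IH] in F P delta eps pP eps_surj exact0 exactS *.
  move=> P0; apply: Hom_acyclic_intro => n g _.
  have F0 (x : F) : x = 0.
    by have [y <-] := eps_surj x; rewrite (P0 0%N isT y) linear0.
  exists \0 => y; by rewrite (F0 (g y)).
move=> P0.
have K0 : eps 0 = 0 by exact: linear0.
have KP a x y : eps x = 0 -> eps y = 0 -> eps (a *: x + y) = 0.
  by move=> x0 y0; rewrite linearP x0 y0 scaler0 addr0.
pose K := subcarrier (Submodule (conj K0 KP)).
have eps'P x : delta 0%N x \in submemb (Submodule (conj K0 KP)).
  by apply/asboolP/exact0; exists x.
pose eps' x : K := Subcarrier (eps'P x).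
have eps'_lin : linear eps' by move=> a x y; apply: val_inj; exact: linearP.
have CK : Hom_acyclic C K.
  apply: (IH _ (fun n => P n.+1) (fun n => delta n.+1) (pack_linear eps'_lin)) => //.
  - move=> y; have /asboolP/exact0[x xy] := valP y.
    by exists x; apply: val_inj.
  - move=> y; rewrite -(exactS 0%N y); split=> [/(congr1 val)//|y0].
    exact: val_inj.
  - by move=> n dn; apply: P0.
apply: (Hom_acyclic_cokernel pC _ eps_surj _ CK (CQ _ (pP 0%N)) (i := \val)).
  exact: val_inj.
move=> y; split=> [y0|[x <-]]; last by have /asboolP := valP x.
have yK : y \in submemb (Submodule (conj K0 KP)) by apply/asboolP.
by exists (Subcarrier yK).
Qed.

(** * The local argument *)

Section Local.
Context (A R S : comPzRingType).
Context (rho : {rmorphism A -> S}) (sigma : {rmorphism R -> S}) (f : A) (g : R).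
Hypotheses (locA : is_localization f rho) (locR : is_localization g sigma).
Context (CA : complex A) (CR : complex R) (CS : complex S).
Context (r : forall n, {linear CA n -> CS n | rho \; *:%R})
        (s : forall n, {linear CR n -> CS n | sigma \; *:%R}).
Hypotheses (locCA : forall n, is_module_localization f (r n))
           (locCR : forall n, is_module_localization g (s n)).
Hypotheses (r_diff : forall n x, r (n - 1) (cdiff CA n x) = cdiff CS n (r n x))
           (s_diff : forall n x, s (n - 1) (cdiff CR n x) = cdiff CS n (s n x)).

(** In the application [A], [R], [S] are the rings of V, U and W. Up to denominators, [z] comes from
    a cycle of [CR], so it bounds in [CS]; clearing denominators over [A] leaves a power of [f]. *)
Lemma local_boundary n (z : CA (n - 1)) : acyclic CR ->
  cdiff CA (n - 1) z = 0 -> exists k y, cdiff CA n y = f ^+ k *: z.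
Proof.
move=> aR dz.
have [_ frac _] := locCR (n - 1); have [_ _ tor] := locCR (n - 1 - 1).
have [k [u uP]] := frac (r (n - 1) z).
have [|l lP] := tor (cdiff CR (n - 1) u).
  by rewrite s_diff -uP linearZ /= -r_diff dz raddf0 scaler0.
have [v vP] : exists v, cdiff CR n v = g ^+ l *: u by apply/aR; rewrite linearZ.
have [v' v'P] := localization_divr locR (l + k) (s n v).
have dv' : cdiff CS n v' = r (n - 1) z.
  apply: (localization_expI locR (k := l + k)).
  rewrite -linearZ /= -v'P -s_diff vP semilinearZ -uP rmorphXn.
  by rewrite scalerA exprD.
have [_ fracA _] := locCA n; have [_ _ torA] := locCA (n - 1).
have [m [w wP]] := fracA v'.
have [|p pP] := torA (f ^+ m *: z - cdiff CA n w).
  by rewrite linearB semilinearZ r_diff -wP linearZ /= dv' rmorphXn subrr.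
exists (p + m)%N, (f ^+ p *: w); apply/esym/eqP.
by rewrite linearZ /= -subr_eq0 exprD -scalerA -scalerBr pP.
Qed.

(* The map lam : J (x) CA -> E is a map from CA to F = Hom_A(J, E), hence from *)
(* CS and from CR to F_f. By coherence F_f is flat over R, so that it has      *)
(* finite projective dimension and the map on CR extends along the             *)
(* differential of CR. Carried back to CA and evaluated at z, this says that   *)
(* lam z vanishes in E_f.                                                      *)
Lemma local_tensor_vanishing (d : nat) (J E : lmodType A) n
    (lam : {linear tensor J (CA (n - 1)) -> E}) (z : tensor J (CA (n - 1))) :
  coherent A -> perfect d R -> totally_acyclic CR ->
  extensible J -> extensible E ->
  (forall x, lam (tensor_map J (cdiff CA n) x) = 0) ->
  tensor_map J (cdiff CA (n - 1)) z = 0 ->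
  exists k, f ^+ k *: lam z = 0.
Proof.
move=> cA pR tR eJ eE lam_d dz.
have [t tP] : exists t : {linear CA (n - 1) -> homs J E},
    forall v j, hom_val (t v) j = lam (pure_tensor j v).
  by apply: curry; have [] := bilinear_linear lam.
have [T [iota locT]] := module_localization_exists locA (homs J E).
have [uS uSP] := module_localization_lift locA (locCA (n - 1)) (iota \o t).
have uS_d w : uS (cdiff CS n w) = 0.
  have [_ frac _] := locCA n; have [k [v wv]] := frac w.
  apply: (localization_expI locA (k := k)).
  rewrite -!linearZ /= wv -r_diff uSP scaler0 /=.
  have -> : t (cdiff CA n v) = 0; last exact: raddf0.
  by apply: hom_inj => j; rewrite tP -tensor_map_pure lam_d.
have uR_lin : linear (uS \o s (n - 1) : CR (n - 1) -> restriction sigma T).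
  by move=> a x y; rewrite /= linearD semilinearZ linearP.
have flatT : flat (restriction sigma T).
  apply/equationally_flat_flat/(equationally_flat_restriction locR).
  exact/(equationally_flat_localization locA locT)/coherent_homs_flat.
have [|h hP] := (proj_dim_Hom_acyclic tR (pR _ flatT) (pack_linear uR_lin)).1.
  by move=> x; rewrite -[LHS]/(uS (s _ _)) s_diff uS_d.
have h_lin : linear_for (sigma \; *:%R) (h : CR (n - 1 - 1) -> T).
  by move=> a x y; rewrite linearP.
have [hS hSP] := module_localization_lift locR (locCR (n - 1 - 1)) (pack_linear h_lin).
have hS_d w : hS (cdiff CS (n - 1) w) = uS w.
  have [_ frac _] := locCR (n - 1); have [k [x wx]] := frac w.
  apply: (localization_expI locR (k := k)).
  by rewrite -!linearZ /= wx -s_diff hSP; exact: hP.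
have [EL [eps locE]] := module_localization_exists locA E.
(* Evaluation at [j], localized to a map from [Hom(J, E)_f] to [E_f]. *)
have /choice[ev evP] : forall j, exists ev : {linear T -> EL},
    forall phi, ev (iota phi) = eps (hom_val phi j).
  move=> j.
  have ej_lin : linear_for (rho \; *:%R) (fun phi : homs J E => eps (hom_val phi j)).
    by move=> a phi psi; rewrite homP linearP.
  by have [ev evP] := module_localization_lift locA locT (pack_linear ej_lin); exists ev.
have evD a i j x : ev (a *: i + j) x = rho a *: ev i x + ev j x.
  have [_ frac _] := locT; have [k [phi xphi]] := frac x.
  apply: (localization_expI locA (k := k)).
  have ev_x j' : rho f ^+ k *: ev j' x = eps (hom_val phi j').
    by rewrite -linearZ /= xphi evP.
  by rewrite scalerDr scalerA mulrC -scalerA !ev_x linearP linearD semilinearZ.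
(* Precomposed with the differential in its second argument, [b] is [eps (lam (pure_tensor j v))];
   hence [eps \o lam] factors through [J (x) d] and kills the cycle [z]. *)
pose b (j : J) (v : CA (n - 1 - 1)) : restriction rho EL := ev j (hS (r _ v)).
have b_bil : is_bilinear b.
  split=> [v a i j|j a v w]; first exact: evD.
  by rewrite /b linearD semilinearZ !linearP.
have el_lin : linear (eps \o lam : tensor J (CA (n - 1)) -> restriction rho EL).
  by move=> a x y; rewrite /= !linearP.
have [_ _ torE] := locE; apply: torE.
rewrite -[LHS]/(pack_linear el_lin z) -tensor_eval_comp.
have b0 : tensor_eval b 0 = 0 := tensor_eval0 b_bil.
rewrite -b0 -dz tensor_eval_map //.
apply: (congr1 (fun c : J -> CA (n - 1) -> restriction rho EL => tensor_eval c z)).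
apply/funext => j; apply/funext => v.
rewrite /b r_diff hS_d uSP /= evP tP.
by [].
Qed.

End Local.

(** * Affine open sets *)

Lemma prime_ideal_above (A : comPzRingType) (I : submodule A^o) :
  ~ I 1 -> exists p : spec A, forall a, I a -> prime_ideal p a.
Proof.
move=> nI1.
have [|H [HQ IH maxH]] := @submodule_max _ _ (fun a : A^o => a <> 1) I.
  by move=> a Ia a1; rewrite a1 in Ia.
have HM a b : H b -> H (a * b) by exact: submemZ.
suff pH : is_prime_ideal (H : set A) by exists (Spec pH).
split.
- exact: (submem0 H).
- by move=> a b; exact: (@submemD _ _ H).
- exact: HM.
- by move/HQ.
move=> a b Hab; have [Ha|nHa] := pselect (H a); [by left|right].
(* The ideal [H + A a]. If [1 = h + c a], then [b = b h + c (a b)] lies in [H]; otherwise maximality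
   forces [a] into [H]. *)
pose K (x : A^o) := exists h c, H h /\ x = h + c * a.
have K0 : K 0 by exists 0, 0; split; [exact: submem0|rewrite mul0r addr0].
have KP c x y : K x -> K y -> K (c *: x + y).
  move=> [h [e [Hh ->]]] [h' [e' [Hh' ->]]].
  exists (c * h + h'), (c * e + e'); split; first exact: (submemP2 c Hh Hh').
  by rewrite -[c *: _]/(c * _); ring.
have [[h [c [Hh hc]]]|nK1] := pselect (K 1).
  have -> : b = b * h + c * (a * b).
    by rewrite -[LHS]mulr1 [X in _ * X]hc; ring.
  by apply: submemD; exact: HM.
exfalso; apply/nHa/(maxH (Submodule (conj K0 KP))).
- by move=> x Kx x1; apply: nK1; rewrite -x1.
- by move=> x Hx; exists x, 0; rewrite mul0r addr0.
- by exists 0, 1; rewrite mul1r add0r; split=> //; exact: submem0.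
Qed.

Section PrimeFacts.
Context (A : comPzRingType) (p : spec A).

Lemma prime_mull a b : prime_ideal p b -> prime_ideal p (a * b).
Proof. by case: (prime_idealP p) => _ _ + _ _; apply. Qed.

Lemma prime_exp a k : prime_ideal p (a ^+ k) -> prime_ideal p a.
Proof.
case: (prime_idealP p) => _ _ _ p1 pM; elim: k => [/p1 //|k IH].
by rewrite exprS => /pM[].
Qed.

End PrimeFacts.

Lemma comap_prime (A B : comPzRingType) (phi : {rmorphism A -> B}) (p : spec B) :
  is_prime_ideal [set a | prime_ideal p (phi a)].
Proof.
case: (prime_idealP p) => p0 pD pM p1 pp; split=> /= [|a b|a b||a b].
- by rewrite rmorph0.
- by rewrite rmorphD; exact: pD.
- by rewrite rmorphM; exact: pM.
- by rewrite rmorph1.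
- by rewrite rmorphM; exact: pp.
Qed.

Lemma distinguished_open (A : comPzRingType) (a : A) : open (distinguished a).
Proof. by rewrite spec_openE => p pa; exists a. Qed.

(** * Units near a point and affine charts *)

Section RingedSpace.
Context (X : ringed_space).
Implicit Types U V W : opens X.

Lemma res_comp U V W (hVU : V `<=` U) (hWV : W `<=` V) (hWU : W `<=` U)
  (s : OX U) : res hWV (res hVU s) = res hWU s.
Proof. by have [_ h _] := OX_sheaf X; rewrite (h U V W hVU hWV hWU s). Qed.

Lemma res_id U (h : U `<=` U) (s : OX U) : res h s = s.
Proof. by have [h1 _ _] := OX_sheaf X; exact: h1. Qed.

(** The germ of [s] at [x] is a unit, said without stalks. *)
Definition invertible_near U (s : OX U) (x : X) : Prop :=
  exists (N : opens X) (h : N `<=` U), carrier N x /\ exists b, res h s * b = 1.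

Lemma invertible_near_res U W (h : W `<=` U) (s : OX U) x : carrier W x ->
  invertible_near (res h s) x <-> invertible_near s x.
Proof.
move=> Wx; split=> [[N [hN [Nx [b sb]]]]|[N [hN [Nx [b sb]]]]].
  exists N, (subset_trans hN h); split=> //; exists b.
  by rewrite -(res_comp h hN).
have h1 : opensI N W `<=` N := @subIsetl _ N W.
have h2 : opensI N W `<=` W := @subIsetr _ N W.
have h' : opensI N W `<=` U := subset_trans h2 h.
exists (opensI N W), h2; split; first by split.
by exists (res h1 b); rewrite (res_comp h _ h') -(res_comp hN h1 h') -rmorphM sb rmorph1.
Qed.

Lemma invertible_nearM U (s t : OX U) x :
  invertible_near s x -> invertible_near t x -> invertible_near (s * t) x.
Proof.
move=> [N [hN [Nx [b sb]]]] [N' [hN' [N'x [c tc]]]].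
have h1 : opensI N N' `<=` N := @subIsetl _ N N'.
have h2 : opensI N N' `<=` N' := @subIsetr _ N N'.
have h : opensI N N' `<=` U := subset_trans h1 hN.
exists (opensI N N'), h; split; first by split.
exists (res h1 b * res h2 c).
rewrite rmorphM mulrACA -{1}(res_comp hN h1 h) -(res_comp hN' h2 h) -!rmorphM.
by rewrite sb tc !rmorph1 mulr1.
Qed.

Lemma invertible_near_mull U (s t : OX U) x :
  invertible_near (s * t) x -> invertible_near t x.
Proof.
move=> [N [hN [Nx [b stb]]]]; exists N, hN; split=> //; exists (res hN s * b).
by rewrite -stb rmorphM; ring.
Qed.

Lemma invertible_near_exp U (s : OX U) k x :
  invertible_near s x -> invertible_near (s ^+ k) x.
Proof.
move=> [N [hN [Nx [b sb]]]]; exists N, hN; split=> //; exists (b ^+ k).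
by rewrite rmorphXn -exprMn sb expr1n.
Qed.

Section Chart.
Context (U : opens X) (A : comPzRingType) (psi : spec A -> X)
  (theta : {rmorphism A -> OX U}) (chart : affine_chart psi theta).

Definition chart_opens (a : A) : opens X :=
  Opens (chart_open chart (@distinguished_open _ a)).

Lemma chart_opens_sub a : chart_opens a `<=` U.
Proof. by rewrite -(chart_range chart) => _ [p _ <-]; exists p. Qed.

Lemma chart_point x : carrier U x -> exists p, x = psi p.
Proof. by rewrite -(chart_range chart) => -[p _ <-]; exists p. Qed.

Lemma chart_opensE (a : A) p : carrier (chart_opens a) (psi p) <-> ~ prime_ideal p a.
Proof.
split=> [[q qa /(chart_inj chart) <-] //|pa]; by exists p.
Qed.

Lemma chart_localization a (h : chart_opens a `<=` U) :
  is_localization a (res h \o theta).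
Proof. exact: (chart_sections chart). Qed.

Lemma chart_surj s : exists a, s = theta a.
Proof.
have h : U `<=` U by [].
have VE : U = psi @` distinguished 1 :> set X.
  rewrite -(chart_range chart) eqEsubset; split=> _ [p _ <-]; exists p => //.
  by case: (prime_idealP p).
have [_ frac _] := chart_sections chart h VE.
have [k [a sa]] := frac s; exists a.
by move: sa; rewrite /= !rmorph1 expr1n mul1r res_id.
Qed.

Lemma chart_localization_sections a V (h : V `<=` U) :
  V = psi @` distinguished a :> set X -> is_localization (theta a) (res h).
Proof.
move=> VE; have [inv frac tor] := chart_sections chart h VE; split=> //.
  by move=> b; have [k [c bc]] := frac b; exists k, (theta c).
move=> b; have [c ->] := chart_surj b => /tor[k kc]; exists k.
by rewrite -rmorphXn -rmorphM kc rmorph0.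
Qed.

Lemma chart_neighbourhood (p : spec A) W : carrier W (psi p) ->
  exists2 a, ~ prime_ideal p a & chart_opens a `<=` W.
Proof.
move=> Wp; have : open (psi @^-1` W).
  by apply: open_comp (carrier_open W) => q _; exact: (chart_continuous chart).
rewrite spec_openE => /(_ p Wp)[a pa aW]; exists a => // _ [q qa <-].
exact: aW.
Qed.

(** Being a unit near a point refers to no chart, so this lets distinguished sets of two different
    charts be compared. *)
Lemma chart_invertible (p : spec A) a :
  invertible_near (theta a) (psi p) <-> ~ prime_ideal p a.
Proof.
split=> [[N [hN [Np [b ab]]]]|pa]; last first.
  exists (chart_opens a), (@chart_opens_sub a); split; first exact/chart_opensE.
  by have [] := chart_localization (@chart_opens_sub a).
have [c pc cN] := chart_neighbourhood Np.
have ab' : (res (@chart_opens_sub c) \o theta) a * res cN b = 1.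
  by rewrite /= -(res_comp hN cN) -rmorphM ab rmorph1.
have [_ frac tor] := chart_localization (@chart_opens_sub c).
have [k [e be]] := frac (res cN b).
(* Since [a] is invertible on [D(c)], a power of [c] is a multiple of [a]; so [a] in [p] would put
   [c] in [p]. *)
have [|l lP] := tor (c ^+ k - a * e).
  by rewrite rmorphB rmorphM rmorphXn -be mulrCA ab' mulr1 subrr.
move=> pa; apply: pc; apply: (@prime_exp _ p _ (l + k)).
have -> : c ^+ (l + k) = (c ^+ l * e) * a.
  apply/eqP; rewrite -subr_eq0 exprD; apply/eqP; rewrite -[RHS]lP; ring.
exact: prime_mull.
Qed.

End Chart.

(** Choose [D(a)] inside V, then [D(b)] inside [D(a)]. On [D(a)] the section of [b] is [c / a^k], so
    [D(b)] is [D(a c)] in the chart of U. *)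
Lemma common_distinguished U V (A B : comPzRingType) (psi : spec A -> X)
    (theta : {rmorphism A -> OX U}) (phi : spec B -> X)
    (eta : {rmorphism B -> OX V}) x :
  affine_chart psi theta -> affine_chart phi eta -> carrier U x -> carrier V x ->
  exists (W : opens X) (a : A) (b : B),
    [/\ W = psi @` distinguished a :> set X, W = phi @` distinguished b :> set X
      & carrier W x].
Proof.
move=> cU cV Ux Vx.
have [p xp] := chart_point cU Ux; rewrite {x}xp in Ux Vx *.
have [a pa aV] := chart_neighbourhood cU Vx.
have W0x : carrier (chart_opens cU a) (psi p) by apply/chart_opensE.
have [q pq] := chart_point cV Vx; rewrite pq in W0x Ux Vx *.
have [b qb bW0] := chart_neighbourhood cV W0x.
have [_ frac _] := chart_localization (@chart_opens_sub _ _ _ _ cU a).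
have [k [c bc]] := frac (res aV (eta b)).
exists (chart_opens cV b), (a * c), b; split=> //; last exact/chart_opensE.
have inv_bc y : carrier (chart_opens cU a) y ->
    (invertible_near (eta b) y <-> invertible_near (theta c) y).
  move=> ay; rewrite -(invertible_near_res aV _ ay).
  rewrite -(invertible_near_res (@chart_opens_sub _ _ _ _ cU a) (theta c) ay).
  rewrite -[res _ (theta c)]/((res _ \o theta) c) -bc.
  split=> [|/invertible_near_mull //]; apply: invertible_nearM.
  apply/invertible_near_exp/invertible_near_res => //.
  by case: ay => r ra <-; exact/chart_invertible.
rewrite eqEsubset; split=> y.
  move=> by_; have ay := bW0 _ by_; have [[r ra ry] [r' r'b r'y]] := (ay, by_).
  exists r => // rac; rewrite -ry in ay r'y.
  have : invertible_near (eta b) (psi r) by rewrite -r'y; exact/chart_invertible.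
  move/(inv_bc _ ay)/(chart_invertible cU) => rc.
  by case: (prime_idealP r) => _ _ _ _ /(_ _ _ rac)[].
move=> [r rac ry].
have ay : carrier (chart_opens cU a) y.
  by exists r => // ra; apply: rac; rewrite mulrC; exact: prime_mull.
have := aV _ ay => /(chart_point cV)[r' yr'].
rewrite yr'; apply/chart_opensE/(chart_invertible cV); rewrite -yr'.
apply/(inv_bc _ ay); rewrite -ry; apply/(chart_invertible cU) => rc; apply: rac.
exact: prime_mull.
Qed.

End RingedSpace.

(** * From an affine covering to all affine open sets *)

(* W is a distinguished open subset both of U, defined by g, and of V, defined *)
(* by f.                                                                       *)
Definition common_localization (X : ringed_space) (U V W : opens X)
    (hU : W `<=` U) (hV : W `<=` V) (g : OX U) (f : OX V) : Prop :=
  [/\ is_localization g (res hU), is_localization f (res hV)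
    & forall M : module_sheaf X, quasi_coherent M ->
        is_module_localization g (mres M hU) /\
        is_module_localization f (mres M hV)].

(** A proper [I] lies in a prime, that is, in a point of V, which some U of the covering contains. A
    common [W = D(f)] around this point has [f] outside the prime, whereas [f^k] in [I] forces [f]
    inside. *)
Lemma affine_local (X : scheme) (C : set (opens X)) (V : opens X)
    (I : submodule (OX V)^o) :
  affine_covering C -> affine V ->
  (forall (U W : opens X) (hU : W `<=` U) (hV : W `<=` V) (g : OX U) (f : OX V),
     C U -> common_localization hU hV g f -> exists k, I (f ^+ k)) ->
  I 1.
Proof.
move=> [affC covC] [A [psi [theta cV]]] loc.
apply: contrapT => /prime_ideal_above[p Ip].
(* The chart is defined on [spec A], so the prime of [OX V] is pulled back along [theta]. *)
pose q := Spec (comap_prime theta p).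
have Vq : carrier V (psi q) by rewrite -(chart_range cV); exists q.
have [U CU Uq] := covC (psi q).
have [B [phi [eta cU]]] := affC _ CU.
have [W [b [a [WB WA Wq]]]] := common_distinguished cU cV Uq Vq.
have hU : W `<=` U by rewrite WB -(chart_range cU) => _ [r _ <-]; exists r.
have hV : W `<=` V by rewrite WA -(chart_range cV) => _ [r _ <-]; exists r.
have [|k Ik] := loc U W hU hV (eta b) (theta a) CU.
  split; [exact: (chart_localization_sections cU)|exact: (chart_localization_sections cV)|].
  by move=> M qcM; split; [exact: (qcM _ _ _ _ cU)|exact: (qcM _ _ _ _ cV)].
move: Wq; rewrite WA => -[r ra /(chart_inj cV) rq]; apply: ra; rewrite rq.
exact: prime_exp (Ip _ Ik).
Qed.

Theorem theorem3p8 (d : nat) (X : scheme) (P : sheaf_complex X)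
    (hcoh : locally_coherent X) (hperf : locally_perfect d X)
    (hP : forall n : int, vector_bundle (P n))
    (hcov : exists2 C : set (opens X), affine_covering C &
       forall U : opens X, C U -> totally_acyclic (sections P U)) :
  F_totally_acyclic_sheaves P.
Proof.
have [C covC tot] := hcov.
have flatP n U : affine U -> flat (P n U).
  by move=> affU; apply/projective_flat/(hP n).2.
split=> [n|V affV]; first by split; [exact: (hP n).1|exact: flatP].
(* The multipliers that make [z] a boundary form an ideal; both acyclicity claims apply
   [affine_local] to it. *)
have boundary_ideal (M N : lmodType (OX V)) (D : {linear M -> N}) (z : N) :
    (exists x, D x = (0 : OX V) *: z) /\
    forall c (a b : (OX V)^o), (exists x, D x = a *: z) -> (exists x, D x = b *: z) ->
      exists x, D x = (c *: a + b) *: z.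
  split=> [|c a b [x xa] [y yb]]; first by exists 0; rewrite linear0 scale0r.
  by exists (c *: x + y); rewrite linearP xa yb scalerA -scalerDl.
split=> [n||J iJ]; first exact: flatP.
- move=> n z; split=> [dz|[x <-]]; last exact: cdiff_cdiff.
  have [x xz] : Submodule (boundary_ideal _ _ (cdiff (sections P V) n) z) 1.
    apply: (affine_local covC affV) => U W hU hV g f CU [locU locV locM].
    have [_ aU _] := tot U CU.
    have [||k [y yz]] := local_boundary locU
       (r := fun n => mres (P n) hV) (s := fun n => mres (P n) hU)
       (CA := sections P V) (CR := sections P U) (CS := sections P W)
       (fun n => (locM _ (hP n).1).2) (fun n => (locM _ (hP n).1).1) _ _ aU dz.
    + by move=> m x; rewrite /= smap_res.
    + by move=> m x; rewrite /= smap_res.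
    by exists k, y.
  by exists x; rewrite xz scale1r.
- move=> n z; split=> [dz|[x <-]]; last exact: tensor_diff_diff.
  set D := cdiff (tensor_complex J (sections P V)) n.
  have im0 : exists x, D x = 0 by exists 0; rewrite linear0.
  have imP a y1 y2 : (exists x, D x = y1) -> (exists x, D x = y2) ->
      exists x, D x = a *: y1 + y2.
    by move=> [x1 <-] [x2 <-]; exists (a *: x1 + x2); rewrite linearP.
  (* [lam] kills exactly the boundaries, so [f ^+ k *: lam z = 0] puts [f ^+ k] in the ideal of
     [z]. *)
  have [E [lam [eE lamP]]] := enough_injectives (Submodule (conj im0 imP)).
  have [x xz] : Submodule (boundary_ideal _ _ D z) 1.
    apply: (affine_local covC affV) => U W hU hV g f CU [locU locV locM].
    have [k kz] := local_tensor_vanishing locV locU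
       (r := fun n => mres (P n) hV) (s := fun n => mres (P n) hU)
       (CA := sections P V) (CR := sections P U) (CS := sections P W)
       (fun n => (locM _ (hP n).1).2) (fun n => (locM _ (hP n).1).1)
       (fun n x => esym (smap_res (sdiff P n) hV x))
       (fun n x => esym (smap_res (sdiff P n) hU x))
       (hcoh _ affV) (hperf _ (covC.1 _ CU)) (tot _ CU)
       (injective_extensible iJ) eE (fun x => (lamP _).2 (ex_intro _ x erefl)) dz.
    by exists k; apply/lamP; rewrite linearZ.
  by exists x; rewrite xz scale1r.
Qed.
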